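(* If $f\in\mathbb R[x,y]$ (commuting variables) is nonnegative on $\mathbb R^2$, then there exists $k\in\mathbb N$ such that $(1+x^2)^kf$ is a sum of squares in $\mathbb R[x,y]$.
   Context: A sum of squares in $\mathbb R[x,y]$ is a finite sum $\sum_i g_i^2$ with $g_i\in\mathbb R[x,y]$. *)

(* Defs.v *)
From mathcomp Require Import all_boot all_order all_algebra.
From mathcomp Require Import reals.
From mathcomp Require Import mpoly.

Set Implicit Arguments.
Unset Strict Implicit.
Unset Printing Implicit Defensive.

Import GRing.Theory.
Local Open Scope ring_scope.

Definition is_sos (A : pzRingType) (p : A) : Prop :=
  exists s : seq A, p = \sum_(g <- s) g ^+ 2.

(* Main.v *)
Require Import Defs.
From HB Require Import structures.
From mathcomp Require Import all_boot all_order all_algebra all_field.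
From mathcomp Require Import boolp classical_sets reals complex polyrcf.
From mathcomp Require Import generic_quotient fraction.
From mathcomp Require Import mpoly.
From mathcomp Require Import zify ring lra.

(* Put q = 1 + y^2 + ... + y^(2d), where 2d bounds the y-degree of f.  A nonnegative f is a sum
   of squares in R(x)[y]: by induction on the y-degree, Cassels' theorem reduces this to showing
   that an irreducible simple factor p of f cannot have a formally real field R(x)[y]/(p), for
   an ordering of that field would yield real points where f < 0.  Clearing denominators,
   h^2 f is a sum of squares in R[x, y] with h in R[x], and real zeros of h cancel.

   To replace h^2 by a power of theta = 1 + x^2, first remove square factors of f.  The squares
   then have coprime roots over R(x), and a Bezout identity gives slack: theta^N f - p q >= 0
   with p = c (prod_i (x - r_i))^2 and c > 0.  Apply the first part to this difference, so that
   h^2 (theta^N f - p q) = sum_i g_i^2 with h free of real zeros, hence coprime to p.  Choose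
   e in R[x, 1/theta] divisible by p, congruent to 1 mod h^2, and so small on R that
   (1 - e) q + (e / p) theta^N f is diagonally dominant in y, hence a sum of squares.  With
   w = (1 - e) / h^2 >= 0,
     theta^N f = w sum_i g_i^2 + p ((1 - e) q + (e / p) theta^N f). *)

Set Implicit Arguments.
Unset Strict Implicit.
Unset Printing Implicit Defensive.

Import Order.TTheory GRing.Theory Num.Theory.
Local Open Scope ring_scope.

(** * Sums of squares and real univariate polynomials *)

(** A repeated factor can make f vanish along a whole curve, and a slack p q with q >= 1 is then
    impossible; hence the removal of square factors. At an isolated real zero of f the slack must
    vanish too, so p has real zeros and e must be a multiple of p for e / p to have no new poles.
    The congruence e = 1 mod h^2 is what makes w free of h. Both conditions can hold together only
    if p and h are coprime, which is why the real zeros of h are cancelled first. The same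
    cancellation keeps h^2 / theta^(deg h) between two positive constants, so high powers of 1 - h^2
    / (C theta^(deg h)) tend to 0 uniformly on R and make e small.

    An ordering of the field R(x)[y]/(p) contains infinitesimals, so its elements are not real
    points. In place of a transfer principle, elements are approximated by Laurent polynomials in
    one positive infinitesimal t, and signs at t are realized at small positive reals. *)

Lemma sos0 (A : pzRingType) : is_sos (0 : A).
Proof. by exists [::]; rewrite big_nil. Qed.

Lemma sos_sqr (A : pzRingType) (a : A) : is_sos (a ^+ 2).
Proof. by exists [:: a]; rewrite big_seq1. Qed.

Lemma sos1 (A : pzRingType) : is_sos (1 : A).
Proof. by rewrite -(expr1n A 2); exact: sos_sqr. Qed.

Lemma sosD (A : pzRingType) (p q : A) : is_sos p -> is_sos q -> is_sos (p + q).
Proof. by move=> [s ->] [t ->]; exists (s ++ t); rewrite big_cat. Qed.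

Lemma sos_sum (A : pzRingType) (I : Type) (r : seq I) (P : pred I) (F : I -> A) :
  (forall i, P i -> is_sos (F i)) -> is_sos (\sum_(i <- r | P i) F i).
Proof. by move=> sF; apply: big_ind => //; [exact: sos0 | exact: sosD]. Qed.

Lemma sosM (A : comPzRingType) (p q : A) : is_sos p -> is_sos q -> is_sos (p * q).
Proof.
move=> [s ->] [t ->]; rewrite big_distrl /=; apply: sos_sum => a _.
by rewrite big_distrr /=; apply: sos_sum => b _; rewrite -exprMn; exact: sos_sqr.
Qed.

Lemma sos_sqrM (A : comPzRingType) (a p : A) : is_sos p -> is_sos (a ^+ 2 * p).
Proof. by apply: sosM; exact: sos_sqr. Qed.

Lemma sos_rmorph (A B : pzRingType) (f : {rmorphism A -> B}) (p : A) :
  is_sos p -> is_sos (f p).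
Proof.
move=> [s ->]; rewrite rmorph_sum; apply: sos_sum => a _.
by rewrite rmorphXn; exact: sos_sqr.
Qed.

Lemma sos_ge0 (A : realDomainType) (p : A) : is_sos p -> 0 <= p.
Proof. by move=> [s ->]; apply: sumr_ge0 => g _; exact: sqr_ge0. Qed.

Lemma quadratic_complex_root (R : rcfType) (a b : R) :
  root (map_poly (real_complex R) (('X - a%:P) ^+ 2 + (b ^+ 2)%:P)) (a +i* b)%C.
Proof.
rewrite /root rmorphD rmorphXn rmorphB /= map_polyX !map_polyC /=.
rewrite !hornerE [X in X - _]complexE /= [_ + 'i%C * _]addrC addrK.
by rewrite exprMn sqr_i rmorphXn mulN1r addNr.
Qed.

Lemma dvdp_of_complex_root (R : rcfType) (p : {poly R}) (a b : R) : b != 0 ->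
  root (map_poly (real_complex R) p) (a +i* b)%C -> ('X - a%:P) ^+ 2 + (b ^+ 2)%:P %| p.
Proof.
move=> b0 zr; set z := (a +i* b)%C in zr; set d := _ + _.
have sd : size d = 3%N by rewrite size_polyDl size_exp_XsubC // size_polyC; case: eqP.
have dz : root (map_poly (real_complex R) d) z by exact: quadratic_complex_root.
have rs : (size (p %% d)%R <= 2)%N by rewrite -ltnS -sd ltn_modpN0 // -size_poly_eq0 sd.
have : (map_poly (real_complex R) (p %% d)).[z] = 0.
  move: zr; rewrite /root {1}(divp_eq p d) rmorphD rmorphM /= hornerD hornerM.
  by rewrite (rootP dz) mulr0 add0r => /eqP.
move=> pz0; apply/eqP; move: (p %% d) rs pz0 => r rs.
have -> : r = r`_1 *: 'X + (r`_0)%:P.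
  apply/polyP => i; rewrite coefD coefZ coefX coefC.
  case: i => [|[|i]] /=; rewrite ?mulr0 ?mulr1 ?add0r ?addr0 //.
  by apply: nth_default; apply: leq_trans rs _.
move: r`_1 r`_0 => r1 r0.
rewrite rmorphD /= linearZ /= map_polyX map_polyC /= !hornerE => E.
have := congr1 (@complex.Im R) E; have := congr1 (@complex.Re R) E.
rewrite /= => E1 E2.
have r1_0 : r1 = 0.
  have : r1 * b = 0 by rewrite -E2; ring.
  by move/eqP; rewrite mulf_eq0 (negPf b0) orbF => /eqP.
have r0_0 : r0 = 0 by rewrite -E1 r1_0; ring.
by rewrite r1_0 r0_0 scale0r addr0.
Qed.

(** A complex root of [p] is real, or it splits off a definite quadratic factor together with its
    conjugate. *)
Lemma real_poly_ind (R : rcfType) (P : {poly R} -> Prop) :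
    (forall c : R, c != 0 -> P c%:P) ->
    (forall (r : R) (q : {poly R}), q != 0 -> P q -> P (('X - r%:P) * q)) ->
    (forall (a b : R) (q : {poly R}), b != 0 -> q != 0 -> P q ->
       P ((('X - a%:P) ^+ 2 + (b ^+ 2)%:P) * q)) ->
  forall p : {poly R}, p != 0 -> P p.
Proof.
move=> Pc Pl Pq p; elim: {p}(size p) {-2}p (leqnn (size p)) => [|n IHn] {}p.
  by rewrite leqn0 size_poly_eq0 => ->.
move=> sp p0; case: (boolP (size p == 1%N)) => [/size_poly1P[c c0 ->]|sp1].
  exact: Pc.
have [z] : exists z, root (map_poly (real_complex R) p) z.
  by apply/closed_rootP; rewrite size_map_poly.
case: (eqVneq (complex.Im z) 0) => [Iz|Iz] zr.
  have /factor_theorem[q pq] : root p (complex.Re z).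
    rewrite -(fmorph_root (real_complex R)) /=.
    by move: zr; rewrite {1}[z]complexE Iz rmorph0 mulr0 addr0.
  have q0 : q != 0 by apply: contra_neq p0 => q0; rewrite pq q0 mul0r.
  rewrite pq mulrC; apply: Pl => //; apply: IHn => //.
  by move: sp; rewrite pq size_Mmonic ?monicXsubC // size_XsubC addn2.
set a := complex.Re z; set b := complex.Im z.
have /dvdpP[q pq] : ('X - a%:P) ^+ 2 + (b ^+ 2)%:P %| p.
  apply: (dvdp_of_complex_root Iz).
  by rewrite (_ : (a +i* b)%C = z) // /a /b; case: (z).
have sd : size (('X - a%:P) ^+ 2 + (b ^+ 2)%:P) = 3%N.
  by rewrite size_polyDl size_exp_XsubC // size_polyC; case: eqP.
have q0 : q != 0 by apply: contra_neq p0 => q0; rewrite pq q0 mul0r.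
rewrite pq mulrC; apply: Pq => //; apply: IHn => //.
move: sp; rewrite pq size_mul // -?size_poly_eq0 ?sd // addn3 /= => h; exact: ltnW.
Qed.

Lemma poly_near_bounded (R : realFieldType) (p : {poly R}) (x : R) :
  exists2 k : R, 0 < k & forall y, `|y - x| <= 1 -> `|p.[y]| <= k.
Proof.
elim/poly_ind: p => [|p c [k k0 kP]].
  by exists 1 => // y _; rewrite horner0 normr0.
exists (k * (1 + `|x|) + `|c| + 1) => [|y yx].
  by rewrite addrC ltr_pwDl // addr_ge0 // mulr_ge0 ?ltW // ltr_pwDl.
rewrite !hornerE (le_trans (ler_normD _ _)) // -addrA lerD //; last by rewrite lerDl.
rewrite normrM ler_pM // ?kP // -[y](subrK x) (le_trans (ler_normD _ _)) //.
by rewrite lerD2r.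
Qed.

(** Continuity in algebraic form, through [p(y) = p(x) + q(y) (y - x)] with [q] bounded near [x].
    This works in any ordered field; it is also applied in [M], which has infinitesimals. *)
Lemma poly_lt0_near (R : realFieldType) (p : {poly R}) (x : R) : p.[x] < 0 ->
  exists2 d : R, 0 < d & forall y, `|y - x| < d -> p.[y] < 0.
Proof.
move=> px.
have /factor_theorem[q pq] : root (p - (p.[x])%:P) x by rewrite /root !hornerE subrr.
have [k k0 kP] := poly_near_bounded q x.
exists (Num.min 1 (- p.[x] / k)) => [|y]; first by rewrite lt_min ltr01 divr_gt0 ?oppr_gt0.
rewrite lt_min => /andP[y1 yk].
have -> : p.[y] = q.[y] * (y - x) + p.[x].
  by rewrite -hornerXsubC -hornerM -pq !hornerE subrK.
rewrite -ltrBrDr sub0r (le_lt_trans (ler_norm _)) // normrM.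
rewrite ltr_pdivlMr // mulrC in yk.
by apply: le_lt_trans yk; rewrite ler_wpM2r // kP // ltW.
Qed.

Lemma poly_avoid (R : rcfType) (p q : {poly R}) (x : R) :
  p.[x] < 0 -> q != 0 -> exists y, p.[y] < 0 /\ q.[y] != 0.
Proof.
move=> /poly_lt0_near[d d0 dP] q0.
(* These are [size q] distinct points at distance less than [d] from [x], more than [q] has
   roots. *)
pose s := [seq x + d / (i.+2)%:R | i <- iota 0 (size q)].
have us : uniq s.
  rewrite map_inj_uniq ?iota_uniq // => i j /addrI /(mulfI (lt0r_neq0 d0)).
  by move/invr_inj/eqP; rewrite eqr_nat => /eqP [].
have : ~~ all (root q) s.
  apply/negP => aq; have := max_poly_roots q0 aq us.
  by rewrite size_map size_iota ltnn.
case/allPn => y /mapP[i _ ->] qy; exists (x + d / (i.+2)%:R); split => //.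
apply: dP; rewrite addrC addKr ger0_norm ?divr_ge0 ?ler0n ?ltW //.
by rewrite ltr_pdivrMr ?ltr0n // ltr_pMr // ltr1n.
Qed.

Lemma poly_ge0_dense (R : rcfType) (p q : {poly R}) : q != 0 ->
  (forall y, q.[y] != 0 -> 0 <= p.[y]) -> forall x, 0 <= p.[x].
Proof.
move=> q0 pq x; rewrite leNgt; apply/negP => px.
have [y [py qy]] := poly_avoid px q0.
by move: (pq y qy); rewrite leNgt py.
Qed.

(** The lower bound on [s] later allows a denominator to be replaced, in an inequality, by the
    product over its real roots. *)
Lemma real_poly_split (R : rcfType) (p : {poly R}) : p != 0 ->
  exists (rs : seq R) (k : R) (s : {poly R}), [/\ p = k *: (\prod_(r <- rs) ('X - r%:P) * s), k != 0, is_sos s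
    & exists2 c : R, 0 < c & forall x, c <= s.[x]].
Proof.
move: p; apply: real_poly_ind => [c c0|r q q0 [rs [k [s [-> k0 ss sx]]]]|a b q b0 q0].
- exists [::], c, 1; split => //; last by exists 1 => // x; rewrite hornerE.
    by rewrite big_nil mulr1 -mul_polyC mulr1.
  exact: sos1.
- exists (r :: rs), k, s; split; [|exact: k0|exact: ss|exact: sx].
  by rewrite big_cons -scalerAr mulrA.
move=> [rs [k [s [-> k0 ss [c c0 cs]]]]].
exists rs, k, ((('X - a%:P) ^+ 2 + (b ^+ 2)%:P) * s); split => //.
- by rewrite -scalerAr; congr (_ *: _); rewrite mulrCA.
- apply: sosM => //; apply: sosD; first exact: sos_sqr.
  by rewrite polyC_exp; exact: sos_sqr.
exists (b ^+ 2 * c) => [|x]; first by rewrite mulr_gt0 // exprn_even_gt0.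
rewrite hornerM; apply: ler_pM => //; rewrite ?sqr_ge0 ?(ltW c0) //.
by rewrite hornerD horner_exp hornerXsubC hornerC lerDr sqr_ge0.
Qed.

Lemma psd_sos (R : rcfType) (p : {poly R}) : (forall x, 0 <= p.[x]) -> is_sos p.
Proof.
elim: {p}(size p) {-2}p (leqnn (size p)) => [|n IHn] p.
  by rewrite leqn0 size_poly_eq0 => /eqP-> _; exact: sos0.
move=> sp px; case: (eqVneq p 0) => [->|p0]; first exact: sos0.
have [rs [k [s [pE k0 ss [c c0 cs]]]]] := real_poly_split p0.
case: rs pE => [|r rs] pE.
  move: px; rewrite pE big_nil mul1r => px.
  have k_ge0 : 0 <= k.
    by move: (px 0); rewrite hornerZ pmulr_lge0 // (lt_le_trans c0).
  by rewrite -mul_polyC -(sqr_sqrtr k_ge0) polyC_exp; exact: sos_sqrM.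
have [q pq] : exists q, p = ('X - r%:P) * q.
  by exists (k *: (\prod_(j <- rs) ('X - j%:P) * s)); rewrite pE big_cons -scalerAr mulrA.
have q0 : q != 0 by apply: contra_neq p0 => q0; rewrite pq q0 mulr0.
(* If [q] did not vanish at [r], then [p] would change sign there; so [('X - r)^2] splits off. *)
have qr : root q r.
  have px' x : 0 <= (x - r) * q.[x] by rewrite -hornerXsubC -hornerM -pq.
  apply/eqP/le_anti/andP; split.
    rewrite leNgt; apply/negP => qr.
    have [|d d0 dP] := @poly_lt0_near R (- q) r; first by rewrite hornerN oppr_lt0.
    have := dP (r - d / 2); have := px' (r - d / 2).
    rewrite hornerN oppr_lt0 [r - _ - r]addrAC subrr add0r normrN ger0_norm; last lra.
    move=> h /(_ ltac:(lra)) h2; have : 0 < d / 2 * q.[r - d / 2] by apply: mulr_gt0; lra.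
    lra.
  rewrite leNgt; apply/negP => qr.
  have [d d0 dP] := poly_lt0_near qr.
  have := dP (r + d / 2); have := px' (r + d / 2).
  rewrite [r + _ - r]addrAC subrr add0r ger0_norm; last lra.
  move=> h /(_ ltac:(lra)) h2.
  have : 0 < d / 2 * - q.[r + d / 2] by apply: mulr_gt0; lra.
  lra.
have [w qw] := factor_theorem _ _ qr.
have w0 : w != 0 by apply: contra_neq q0 => w0; rewrite qw w0 mul0r.
have pw : p = ('X - r%:P) ^+ 2 * w by rewrite pq qw expr2; ring.
rewrite pw; apply: sos_sqrM; apply: IHn.
  move: sp; rewrite pq qw mulrC !size_Mmonic ?monicXsubC // ?mulf_neq0 ?polyXsubC_eq0 //.
  by rewrite size_XsubC !addn2 /= => /ltnW.
apply: (@poly_ge0_dense R w ('X - r%:P)); first by rewrite polyXsubC_eq0.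
move=> y yr; move: (px y); rewrite pw hornerM horner_exp pmulr_rge0 //.
by rewrite exprn_even_gt0.
Qed.

Lemma no_root_sqr_ge (R : rcfType) (h : {poly R}) : h != 0 ->
  (forall x, h.[x] != 0) ->
  exists2 c : R, 0 < c & forall x, c * (1 + x ^+ 2) ^+ (size h).-1 <= h.[x] ^+ 2.
Proof.
move: h; apply: real_poly_ind => [c c0 _|r q q0 _ /(_ r)|a b q b0 q0 IH hx].
- exists (c ^+ 2) => [|x]; first by rewrite exprn_even_gt0.
  by rewrite size_polyC c0 expr0 mulr1 hornerC.
- by rewrite hornerM hornerXsubC subrr mul0r eqxx.
have [|c c0 cP] := IH.
  by move=> x; move: (hx x); rewrite hornerM mulf_eq0 negb_or => /andP[].
have b2 : 0 < b ^+ 2 by rewrite exprn_even_gt0.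
(* By [x^2 <= 2 (x - a)^2 + 2 a^2], the quadratic factor is at least [(1 + x^2) / e]. *)
pose e := 2 + (1 + 2 * a ^+ 2) / b ^+ 2.
have e0 : 0 < e by rewrite /e ltr_pwDl // divr_ge0 ?ltW // ltr_pwDl // mulr_ge0 ?sqr_ge0.
exists (c / e ^+ 2) => [|x]; first by rewrite divr_gt0 // exprn_gt0.
set d := _ + (_)%:P.
have sd : size d = 3%N by rewrite size_polyDl size_exp_XsubC // size_polyC; case: eqP.
have d0 : d != 0 by rewrite -size_poly_eq0 sd.
have -> : (size (d * q)).-1 = ((size q).-1 + 2)%N.
  have : (0 < size q)%N by rewrite size_poly_gt0.
  by rewrite size_mul // sd addSn addSn addSn /=; case: (size q) => // n _; rewrite addn2.
rewrite exprD hornerM exprMn.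
have h1 : 1 + x ^+ 2 <= e * d.[x].
  rewrite hornerD horner_exp hornerXsubC hornerC /e mulrDl.
  have : (1 + 2 * a ^+ 2) <= (1 + 2 * a ^+ 2) / b ^+ 2 * ((x - a) ^+ 2 + b ^+ 2).
    rewrite mulrAC ler_pdivlMr // ler_pM2l; last by rewrite ltr_pwDl // mulr_ge0 ?sqr_ge0.
    by rewrite lerDr sqr_ge0.
  have := sqr_ge0 (x - a - a); nra.
have h2 : (1 + x ^+ 2) ^+ 2 <= e ^+ 2 * d.[x] ^+ 2.
  by rewrite -exprMn lerXn2r // nnegrE ?(le_trans _ h1) ?addr_ge0 ?sqr_ge0.
have e2 : 0 < e ^+ 2 by rewrite exprn_gt0.
rewrite [c / _ * _]mulrAC ler_pdivrMr // mulrA [leRHS]mulrAC.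
rewrite [d.[x] ^+ 2 * _]mulrC [leRHS]mulrC; apply: ler_pM => //.
- by rewrite mulr_ge0 ?(ltW c0) // exprn_ge0 // addr_ge0 // sqr_ge0.
- by rewrite sqr_ge0.
Qed.

(** * Orderings of formally real fields *)

(** This is a preordering in the sense of Artin and Schreier. *)
Definition precone (L : fieldType) (T : L -> Prop) :=
  [/\ forall a, T (a ^+ 2), forall a b, T a -> T b -> T (a + b),
      forall a b, T a -> T b -> T (a * b) & ~ T (-1)].

Lemma precone_maximal (L : fieldType) : ~ is_sos (-1 : L) ->
  exists2 T : L -> Prop, precone T &
    forall S : L -> Prop, precone S -> (forall a, T a -> S a) -> forall a, S a -> T a.
Proof.
move=> sosN1.
have sosT : precone (@is_sos L).
  by split; [exact: sos_sqr | exact: sosD | exact: sosM | exact: sosN1].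
pose P (A : set L) := (forall a, ~ A a) \/ precone A.
have [|A [PA maxA]] := @Zorn_bigcup L P.
  move=> F FP totF.
  have [[X FX [x Xx]]|none] := pselect (exists2 X, F X & exists x, X x); last first.
    by left=> a [X FX Xa]; apply: none; exists X => //; exists a.
  have Fcone Y y : F Y -> Y y -> precone Y by move=> FY Yy; case: (FP _ FY) => // /(_ y).
  right; split.
  - by move=> a; exists X => //; have [] := Fcone _ _ FX Xx.
  - move=> a b [Y FY Ya] [Z FZ Zb].
    have [sub|sub] := totF _ _ FY FZ.
      by exists Z => //; have [_ D _ _] := Fcone _ _ FZ Zb; apply: D => //; exact: sub.
    by exists Y => //; have [_ D _ _] := Fcone _ _ FY Ya; apply: D => //; exact: sub.
  - move=> a b [Y FY Ya] [Z FZ Zb].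
    have [sub|sub] := totF _ _ FY FZ.
      by exists Z => //; have [_ _ M _] := Fcone _ _ FZ Zb; apply: M => //; exact: sub.
    by exists Y => //; have [_ _ M _] := Fcone _ _ FY Ya; apply: M => //; exact: sub.
  - by case=> Y FY Y1; have [_ _ _] := Fcone _ _ FY Y1.
exists A.
  case: PA => // A0; exfalso; apply: (maxA (@is_sos L)); last by right.
  by split=> [a /A0 //|/(_ 0 (sos0 L)) /A0].
move=> S coneS AS a Sa; apply: contrapT => nAa.
by apply: (maxA S); [split=> [b /AS //|/(_ a Sa)] | right].
Qed.

(** If [a] is not in [T], then [T - a T] is again a precone: [-1 = u - a v] with [v != 0] would give
    [a = (1 + u) v / v^2] in [T]. It contains [T] and [- a], so maximality applies. *)
Lemma precone_total (L : fieldType) (T : L -> Prop) : precone T ->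
    (forall S : L -> Prop, precone S -> (forall a, T a -> S a) -> forall a, S a -> T a) ->
  forall a, T a \/ T (- a).
Proof.
move=> [Tsq TD TM TN1] maxT a.
have T0 : T 0 by have := Tsq 0; rewrite expr0n.
have T1 : T 1 by rewrite -(expr1n L 2); exact: Tsq.
have [Ta|nTa] := pselect (T a); [by left | right].
pose S b := exists u v, [/\ T u, T v & b = u - a * v].
have TS b : T b -> S b by move=> Tb; exists b, 0; rewrite mulr0 subr0.
apply: (maxT S) => //; last by exists 0, 1; rewrite mulr1 sub0r.
split.
- by move=> b; apply: TS.
- move=> _ _ [u [v [Tu Tv ->]]] [u' [v' [Tu' Tv' ->]]].
  by exists (u + u'), (v + v'); split; [exact: TD|exact: TD|ring].
- move=> _ _ [u [v [Tu Tv ->]]] [u' [v' [Tu' Tv' ->]]].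
  exists (u * u' + a ^+ 2 * (v * v')), (u * v' + u' * v); split; last ring.
    by apply: (TD); [|apply: (TM) => //]; exact: TM.
  by apply: (TD); exact: TM.
- move=> [u [v [Tu Tv E]]]; apply: nTa.
  case: (eqVneq v 0) => [v0|v0]; first by case: TN1; rewrite E v0 mulr0 subr0.
  have -> : a = (1 + u) * v * v^-1 ^+ 2.
    have : a * v = 1 + u by rewrite -[1]opprK E; ring.
    by move=> <-; field.
  by apply: (TM) => //; apply: (TM) => //; exact: TD.
Qed.

(** [M] is [L] with a maximal precone as its nonnegative elements, and [f] is the identity.
    Surjectivity of [f] is how [M] will inherit algebraicity from [L]. *)
Lemma formally_real_order (L : fieldType) : ~ is_sos (-1 : L) ->
  exists (M : realFieldType) (f : {rmorphism L -> M}), forall y, exists x, f x = y.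
Proof.
move=> /precone_maximal[T coneT maxT].
have tot := precone_total coneT maxT.
have [Tsq TD TM TN1] := coneT.
have Tanti x : T x -> T (- x) -> x = 0.
  move=> Tx TNx; apply: contrapT => /eqP x0; apply: TN1.
  have -> : -1 = x * - x * x^-1 ^+ 2 by field.
  by apply: (TM) => //; exact: TM.
pose le (x y : L) := `[< T (y - x) >].
pose lt (x y : L) := (y != x) && le x y.
pose nrm (x : L) := if le 0 x then x else - x.
have le0E x : le 0 x = `[< T x >] by rewrite /le subr0.
have leE0 x : le x 0 = `[< T (- x) >] by rewrite /le sub0r.
have le0_add x y : le 0 x -> le 0 y -> le 0 (x + y).
  by rewrite !le0E => /asboolP Tx /asboolP Ty; apply/asboolP; exact: TD.
have le0_mul x y : le 0 x -> le 0 y -> le 0 (x * y).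
  by rewrite !le0E => /asboolP Tx /asboolP Ty; apply/asboolP; exact: TM.
have le0_anti x : le 0 x -> le x 0 -> x = 0.
  by rewrite le0E leE0 => /asboolP Tx /asboolP; exact: Tanti.
have sub_ge0 x y : le 0 (y - x) = le x y by rewrite le0E.
have le0_total x : le 0 x || le x 0.
  by rewrite le0E leE0; case: (tot x) => Tx; apply/orP; [left|right]; apply/asboolP.
have nrmN x : nrm (- x) = nrm x.
  rewrite /nrm !le0E opprK; case: asboolP => TNx; case: asboolP => Tx //.
    by rewrite (Tanti _ Tx TNx) oppr0.
  by case: (tot x).
have ge0_nrm x : le 0 x -> nrm x = x by rewrite /nrm => ->.
pose mix := Num.IntegralDomain_isLeReal.Build L
  le0_add le0_mul le0_anti sub_ge0 le0_total nrmN ge0_nrm (fun _ _ => erefl).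
pose M : realFieldType := HB.pack L mix.
exists M, (idfun : {rmorphism L -> L}) => y.
by exists y.
Qed.

(** * Curves at an ordering of their function field *)

Section Infinitesimals.
Variables (R : realType) (M : realFieldType) (e : {rmorphism R -> M}).

(** Relative to [R], these are the convex valuation ring of the ordering, its maximal ideal and its
    units. *)
Definition finite_elt (z : M) := exists r : R, `|z| <= e r.
Definition infinitesimal (z : M) := forall r : R, 0 < r -> `|z| <= e r.
Definition unit_elt (z : M) := finite_elt z /\ ~ infinitesimal z.

(** Any ring morphism out of [R] preserves the order, because nonnegative reals are squares. *)
Lemma emb_ge0 r : (0 <= e r) = (0 <= r).
Proof.
have pos s : 0 <= s -> 0 <= e s by move=> /sqr_sqrtr <-; rewrite rmorphXn sqr_ge0.
apply/idP/idP => [er|/pos//]; rewrite leNgt; apply/negP => r0.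
have : e r = 0 by apply/le_anti; rewrite er -oppr_ge0 -rmorphN pos // oppr_ge0 ltW.
by move/eqP; rewrite fmorph_eq0 lt_eqF.
Qed.

Lemma emb_le r s : (e r <= e s) = (r <= s).
Proof. by rewrite -subr_ge0 -rmorphB emb_ge0 subr_ge0. Qed.

Lemma emb_lt r s : (e r < e s) = (r < s).
Proof. by rewrite !ltNge emb_le. Qed.

Lemma emb_norm r : `|e r| = e `|r|.
Proof.
case: (lerP 0 r) => r0; first by rewrite !ger0_norm ?emb_ge0.
by rewrite !ltr0_norm ?rmorphN // -(rmorph0 e) emb_lt.
Qed.

Lemma finite_emb r : finite_elt (e r).
Proof. by exists `|r|; rewrite emb_norm. Qed.

Lemma finiteD z w : finite_elt z -> finite_elt w -> finite_elt (z + w).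
Proof.
by move=> [r zr] [s ws]; exists (r + s); rewrite rmorphD (le_trans (ler_normD _ _)) ?lerD.
Qed.

Lemma finiteM z w : finite_elt z -> finite_elt w -> finite_elt (z * w).
Proof. by move=> [r zr] [s ws]; exists (r * s); rewrite rmorphM normrM ler_pM. Qed.

Lemma infinitesimal_finite z : infinitesimal z -> finite_elt z.
Proof. by move=> zi; exists 1; exact: zi. Qed.

Lemma infinitesimal0 : infinitesimal 0.
Proof. by move=> r r0; rewrite normr0 emb_ge0 ltW. Qed.

Lemma infinitesimalN z : infinitesimal z -> infinitesimal (- z).
Proof. by move=> zi r; rewrite normrN; exact: zi. Qed.

Lemma infinitesimalD z w : infinitesimal z -> infinitesimal w -> infinitesimal (z + w).
Proof.
move=> zi wi r r0; have r2 : 0 < r / 2 by rewrite divr_gt0.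
by rewrite (splitr r) rmorphD (le_trans (ler_normD _ _)) // lerD ?zi ?wi.
Qed.

Lemma infinitesimalM z w : infinitesimal z -> finite_elt w -> infinitesimal (z * w).
Proof.
move=> zi [s ws] r r0.
have s0 : 0 <= s by rewrite -emb_ge0 (le_trans _ ws).
have s1 : 0 < s + 1 by rewrite ltr_wpDl.
rewrite normrM (le_trans (_ : _ <= e (r / (s + 1)) * e (s + 1))) //.
  apply: ler_pM => //; first by apply: zi; rewrite divr_gt0.
  by rewrite (le_trans ws) // emb_le lerDl.
by rewrite -rmorphM mulfVK ?lt0r_neq0.
Qed.

Lemma infinitesimal_emb r : infinitesimal (e r) -> r = 0.
Proof.
move=> ri; apply/eqP/negPn/negP => r0.
have := ri (`|r| / 2); rewrite divr_gt0 ?normr_gt0 // emb_norm emb_le => /(_ isT).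
have : 0 < `|r| by rewrite normr_gt0.
lra.
Qed.

Lemma unit_emb r : r != 0 -> unit_elt (e r).
Proof. by move=> r0; split; [exact: finite_emb|move/infinitesimal_emb/eqP; rewrite (negPf r0)]. Qed.

Lemma unit1 : unit_elt 1.
Proof. by rewrite -(rmorph1 e); apply: unit_emb; exact: oner_neq0. Qed.

Lemma unit_neq0 z : unit_elt z -> z != 0.
Proof. by move=> [_ zi]; apply/eqP => z0; apply: zi; rewrite z0; exact: infinitesimal0. Qed.

Lemma not_infinitesimalV z : ~ infinitesimal z -> finite_elt z^-1.
Proof.
move=> /existsNP[r /not_implyP[r0 /negP]]; rewrite -ltNge => rz.
exists r^-1; rewrite normfV fmorphV lef_pV2 ?posrE ?ltW //.
  by rewrite (lt_trans _ rz) // -(rmorph0 e) emb_lt.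
by rewrite -(rmorph0 e) emb_lt.
Qed.

Lemma not_finiteV z : ~ finite_elt z -> infinitesimal z^-1.
Proof.
move=> zf r r0; rewrite normfV.
have er : 0 < e r by rewrite -(rmorph0 e) emb_lt.
have : e r^-1 < `|z| by rewrite ltNge; apply/negP => h; apply: zf; exists r^-1.
move=> h; rewrite -[e r]invrK lef_pV2 ?posrE ?invr_gt0 ?ltW // -?fmorphV //.
by rewrite (lt_trans _ h) // fmorphV invr_gt0.
Qed.

Lemma unitV z : unit_elt z -> unit_elt z^-1.
Proof.
move=> uz; have [zf zi] := uz; split; first exact: not_infinitesimalV.
move=> zVi; apply: (unit1.2); rewrite -(mulVf (unit_neq0 uz)).
exact: infinitesimalM.
Qed.

Lemma unitM z w : unit_elt z -> unit_elt w -> unit_elt (z * w).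
Proof.
move=> uz uw; split; first by apply: finiteM; [exact: uz.1|exact: uw.1].
move=> zw; apply: (uz.2); rewrite -[z](mulfK (unit_neq0 uw)).
by apply: infinitesimalM => //; exact: (unitV uw).1.
Qed.

Lemma unitX z n : unit_elt z -> unit_elt (z ^+ n).
Proof.
move=> uz; elim: n => [|n IHn]; first by rewrite expr0; exact: unit1.
by rewrite exprS; exact: unitM.
Qed.

Lemma unitDi z w : unit_elt z -> infinitesimal w -> unit_elt (z + w).
Proof.
move=> [zf zi] wi; split; first by apply: finiteD => //; exact: infinitesimal_finite.
move=> zw; apply: zi; rewrite -[z](addrK w).
by apply: infinitesimalD => //; exact: infinitesimalN.
Qed.

(** The standard part is the supremum of the reals below [z], by completeness of [R]. *)
Lemma residue z : finite_elt z -> exists c, infinitesimal (z - e c).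
Proof.
move=> [r zr]; pose S : set R := [set x | e x <= z]%classic.
have r_ge0 : 0 <= r by rewrite -emb_ge0 (le_trans _ zr).
have Sub x : S x -> x <= r.
  by rewrite /S /= => xz; rewrite -emb_le (le_trans xz) // (le_trans (ler_norm _)).
have hS : has_sup S.
  split; last by exists r => x /Sub.
  exists (- r); rewrite /S /= rmorphN lerNl (le_trans _ zr) //.
  by rewrite -normrN ler_norm.
exists (sup S) => d d0.
have -> : (`|z - e (sup S)| <= e d) = (e (sup S - d) <= z <= e (sup S + d)).
  by rewrite ler_distl rmorphB rmorphD.
apply/andP; split.
  have [s Ss ds] := sup_adherent d0 hS.
  by rewrite (le_trans _ Ss) // emb_le ltW.
rewrite leNgt; apply/negP => h.
have : S (sup S + d) by rewrite /S /= ltW.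
by move/(ub_le_sup (proj2 hS)); rewrite gerDl leNgt d0.
Qed.

(** Divide by a term of largest absolute value: were all other quotients infinitesimal, 1 would be
    infinitesimal. So two nonzero terms have the same valuation. *)
Lemma unit_fraction_of_sum_eq0 (m : nat) (w : 'I_m -> M) (i0 : 'I_m) :
    \sum_i w i = 0 -> w i0 != 0 ->
  exists i j, [/\ i != j, w i != 0, w j != 0 & unit_elt (w i / w j)].
Proof.
move=> w0 wi0; pose j := [arg max_(j > i0) `|w j|]%O.
have jP i : `|w i| <= `|w j|.
  by rewrite /j; case: Order.TotalTheory.arg_maxP => // k _ /(_ i); apply.
have wj : w j != 0 by rewrite -normr_gt0 (lt_le_trans _ (jP i0)) // normr_gt0.
apply: contrapT => none.
have infi i : i != j -> infinitesimal (w i / w j).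
  move=> ij; apply: contrapT => ni; apply: none; exists i, j; split => //.
    by apply/eqP => wi; apply: ni; rewrite wi mul0r; exact: infinitesimal0.
  split => //; exists 1; rewrite rmorph1 normrM normfV ler_pdivrMr ?normr_gt0 //.
  by rewrite mul1r.
apply: (unit1.2).
have -> : 1 = - \sum_(i | i != j) w i / w j.
  have := congr1 (fun x => x / w j) w0.
  rewrite (bigD1 j) //= mulrDl mul0r divff // mulr_suml => /eqP.
  by rewrite addr_eq0 => /eqP.
apply: infinitesimalN; apply: big_ind => //; first exact: infinitesimal0.
exact: infinitesimalD.
Qed.

Section Transcendental.
Variable X : M.
Let a (q : {poly R}) : M := (map_poly e q).[X].
Hypothesis aX : forall q, q != 0 -> a q != 0.

Let aM p q : a (p * q) = a p * a q. Proof. by rewrite /a rmorphM hornerM. Qed.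
Let aD p q : a (p + q) = a p + a q. Proof. by rewrite /a rmorphD hornerD. Qed.
Let aC c : a c%:P = e c. Proof. by rewrite /a map_polyC hornerC. Qed.
Let a_X : a 'X = X. Proof. by rewrite /a map_polyX hornerX. Qed.

(** The parameter is [X] minus its standard part if [X] is finite, and [X^-1] otherwise. The pair
    [u], [v] encodes an integer exponent. *)
Lemma infinitesimal_parameter : exists x : M, [/\ x != 0, infinitesimal x &
  forall q, q != 0 -> exists u v, unit_elt (a q * x ^+ u / x ^+ v)].
Proof.
have [fX|nfX] := pselect (finite_elt X).
  have [c Xc] := residue fX.
  have aXc : a ('X - c%:P) = X - e c by rewrite aD a_X -polyCN aC rmorphN.
  have x0 : X - e c != 0 by rewrite -aXc; apply: aX; rewrite polyXsubC_eq0.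
  exists (X - e c); split => // q.
  have afin p : finite_elt (a p).
    elim/poly_ind: p => [|p d pf]; first by rewrite -polyC0 aC; exact: finite_emb.
    rewrite aD aM a_X aC; apply: finiteD; last exact: finite_emb.
    exact: finiteM.
  elim: {q}(size q) {-2}q (leqnn (size q)) => [|n IHn] q.
    by rewrite leqn0 size_poly_eq0 => ->.
  move=> sq q0; have /factor_theorem[p qp] : root (q - (q.[c])%:P) c.
    by rewrite /root !hornerE subrr.
  case: (eqVneq q.[c] 0) => [qc|qc].
    have qE : q = p * ('X - c%:P) by rewrite -qp qc subr0.
    have p0 : p != 0 by apply: contra_neq q0 => p0; rewrite qE p0 mul0r.
    have [|u [v uv]] := IHn p _ p0.
      by move: sq; rewrite qE size_Mmonic ?monicXsubC // size_XsubC addn2.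
    exists u, v.+1; rewrite qE aM aXc exprS.
    suff -> : a p * (X - e c) * (X - e c) ^+ u / ((X - e c) * (X - e c) ^+ v)
      = a p * (X - e c) ^+ u / (X - e c) ^+ v by [].
    by field; rewrite x0 expf_neq0.
  exists 0, 0; rewrite expr0 mulr1 divr1.
  have -> : q = (q.[c])%:P + ('X - c%:P) * p by rewrite mulrC -qp addrC subrK.
  rewrite aD aC aM aXc; apply: unitDi; first exact: unit_emb.
  exact: infinitesimalM.
have X0 : X != 0 by rewrite -a_X; apply: aX; rewrite polyX_eq0.
have Xi := not_finiteV nfX.
exists X^-1; split => //; first by rewrite invr_eq0.
suff H q : q != 0 -> exists u, unit_elt (a q * X^-1 ^+ u).
  by move=> q /H[u uq]; exists u, 0; rewrite expr0 divr1.
elim/poly_ind: q => [|q c IHq]; first by rewrite eqxx.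
case: (eqVneq q 0) => [->|q0] h.
  move: h; rewrite mul0r add0r polyC_eq0 => c0.
  by exists 0; rewrite expr0 mulr1 aC; exact: unit_emb.
have [u uq] := IHq q0; exists u.+1.
have -> : a (q * 'X + c%:P) * X^-1 ^+ u.+1 = a q * X^-1 ^+ u + X^-1 * (X^-1 ^+ u * e c).
  by rewrite aD aM a_X aC exprS -[in RHS](mulr1 (a q)) -(divff X0); ring.
apply: unitDi => //; apply: infinitesimalM => //.
apply: finiteM; last exact: finite_emb.
elim: (u) => [|k IHk]; first by rewrite expr0; exact: (unit1.1).
by rewrite exprS; apply: finiteM => //; exact: infinitesimal_finite.
Qed.

Variable n : nat.
Hypothesis algM : forall z : M, exists Q : {poly {poly R}},
  [/\ Q != 0, (size Q <= n.+1)%N & \sum_(i < n.+1) a Q`_i * z ^+ i = 0].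

(* Dependence of 1, z, ..., z^n over R(X) gives every infinitesimal z a valuation in (1/n!)Z,
   normalized by a parameter x of R(X); t is an element of least positive valuation. *)
Lemma uniformizer : exists t : M,
  [/\ 0 < t, infinitesimal t, forall z, infinitesimal z -> finite_elt (z / t)
    & forall z, exists m, finite_elt (z * t ^+ m)].
Proof.
have [x [x0 xi xP]] := infinitesimal_parameter.
have infX z k : infinitesimal z -> infinitesimal (z ^+ k.+1).
  move=> zi; elim: k => [|k IHk]; first by rewrite expr1.
  by rewrite exprS; apply: infinitesimalM => //; exact: infinitesimal_finite.
have ordP z : z != 0 -> infinitesimal z -> exists k, unit_elt (z ^+ n`! / x ^+ k.+1).
  move=> z0 zi; have [Q [Q0 sQ Qz]] := algM z.
  have Qi : Q`_(size Q).-1 != 0 by rewrite -lead_coefE lead_coef_eq0.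
  have lQ : ((size Q).-1 < n.+1)%N by rewrite prednK ?size_poly_gt0.
  have w0 i : (a Q`_i * z ^+ i != 0) = (Q`_i != 0).
    rewrite mulf_eq0 negb_or expf_neq0 // andbT.
    apply/idP/idP => [|/aX //]; apply: contra_neq => ->.
    by rewrite -polyC0 aC rmorph0.
  (* Two terms of equal valuation make [z^(i - j)] a unit times a power of [x], and [i - j <= n]
     divides [n!]. *)
  have [|i [j [ij wi wj uij]]] := @unit_fraction_of_sum_eq0 n.+1
    (fun i => a Q`_i * z ^+ i) (Ordinal lQ) Qz; first by rewrite w0.
  wlog lij : i j ij wi wj uij / (j < i)%N.
    move=> H; case: (ltngtP i j) => [h|h|h].
    - by apply: (H j i) => //; [rewrite eq_sym|rewrite -invf_div; exact: unitV].
    - exact: (H i j).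
    - by move: ij; rewrite -val_eqE /= h eqxx.
  rewrite !w0 in wi wj.
  have [u [v uv]] := xP _ wi; have [u' [v' uv']] := xP _ wj.
  pose d := (i - j)%N.
  have d0 : (0 < d)%N by rewrite subn_gt0.
  have dn : (d <= n)%N by rewrite (leq_trans (leq_subr _ _)) // -ltnS.
  have U : unit_elt (z ^+ d * x ^+ (v + u') / x ^+ (u + v')).
    have -> : z ^+ d * x ^+ (v + u') / x ^+ (u + v') =
       (a Q`_i * z ^+ i) / (a Q`_j * z ^+ j) * (a Q`_i * x ^+ u / x ^+ v)^-1
       * (a Q`_j * x ^+ u' / x ^+ v').
      rewrite -[in z ^+ i](subnKC (ltnW lij)) -/d !exprD; field.
      by rewrite !expf_neq0 // !aX.
    by apply: unitM => //; apply: unitM => //; exact: unitV.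
  have luv : (v + u' < u + v')%N.
    rewrite ltnNge; apply/negP => h; apply: (U.2).
    rewrite -(subnKC h) exprD [x ^+ (u + v') * _]mulrC mulrA mulfK ?expf_neq0 //.
    rewrite -[d]prednK //; apply: infinitesimalM; first exact: infX.
    case: (_ - _)%N => [|k]; first by rewrite expr0; exact: (unit1.1).
    by apply: infinitesimal_finite; exact: infX.
  have U' : unit_elt (z ^+ d / x ^+ (u + v' - (v + u'))).
    move: U; rewrite -[in x ^+ (u + v')](subnKC (ltnW luv)).
    by rewrite [x ^+ (_ + (_ - _))]exprD invfM mulrA mulfK ?expf_neq0.
  have dE : (d * (n`! %/ d))%N = n`! by rewrite mulnC divnK // dvdn_fact // d0.
  pose m := ((u + v' - (v + u')) * (n`! %/ d))%N.
  have m0 : (0 < m)%N by rewrite muln_gt0 subn_gt0 luv divn_gt0 // dvdn_leq ?fact_gt0 // dvdn_fact // d0.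
  exists m.-1; rewrite prednK // -dE !exprM -expr_div_n; exact: unitX.
pose P k := `[< exists z, [/\ z != 0, infinitesimal z & unit_elt (z ^+ n`! / x ^+ k.+1)] >].
have exP : exists k, P k.
  by have [k uk] := ordP x x0 xi; exists k; apply/asboolP; exists x.
case: (ex_minnP exP) => k /asboolP[t [t0 ti ut]] kmin.
(* If [t / z] were infinitesimal, the exponent [k + 1] of [t] would be the sum of the positive
   exponents of [t / z] and [z], although that of [z] is at least [k + 1] by minimality. *)
have tP z : infinitesimal z -> finite_elt (z / t).
  have [->|z0] := eqVneq z 0; first by exists 0; rewrite mul0r normr0 rmorph0.
  move=> zi; apply: contrapT => /not_finiteV; rewrite invf_div => tzi.
  have tz0 : t / z != 0 by rewrite mulf_neq0 ?invr_eq0.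
  have [k1 u1] := ordP _ tz0 tzi; have [k2 u2] := ordP _ z0 zi.
  have k2P : P k2 by apply/asboolP; exists z.
  have kk2 := kmin _ k2P.
  have := unitM (unitM u1 u2) (unitV ut).
  have -> : (t / z) ^+ n`! / x ^+ k1.+1 * (z ^+ n`! / x ^+ k2.+1) * (t ^+ n`! / x ^+ k.+1)^-1
    = (x ^+ (k1 + (k2 - k)).+1)^-1.
    rewrite expr_div_n -addSn exprD -[in x ^+ k2.+1](subnKC kk2) -addSn exprD.
    by field; rewrite !expf_neq0.
  by move/unitV; rewrite invrK => -[_]; apply; exact: infX.
have tM z : exists m, finite_elt (z * t ^+ m).
  have [zf|zf] := pselect (finite_elt z); first by exists 0; rewrite expr0 mulr1.
  have z0 : z != 0 by apply: contra_notN zf => /eqP ->; exists 0; rewrite normr0 rmorph0.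
  have [||k1 u1] := ordP z^-1; [by rewrite invr_eq0 | exact: not_finiteV | ].
  (* The exponents add up to [(k + 1) (k1 + 1) - (k1 + 1) = k (k1 + 1) >= 0], so the pole of [z] is
     cleared. *)
  have U : unit_elt ((z * t ^+ k1.+1) ^+ n`! / x ^+ (k * k1.+1)).
    have := unitM (unitV u1) (unitX k1.+1 ut).
    suff -> : (z^-1 ^+ n`! / x ^+ k1.+1)^-1 * (t ^+ n`! / x ^+ k.+1) ^+ k1.+1 =
      (z * t ^+ k1.+1) ^+ n`! / x ^+ (k * k1.+1) by [].
    rewrite expr_div_n -!exprM [(k.+1 * _)%N]mulSn exprD exprMn exprVn -exprM [(n`! * _)%N]mulnC.
    by field; rewrite !expf_neq0.
  exists k1.+1; apply: contrapT => /not_finiteV zi; apply: (unit1.2).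
  have -> : 1 = ((z * t ^+ k1.+1)^-1) ^+ n`! * ((z * t ^+ k1.+1) ^+ n`! / x ^+ (k * k1.+1)
     * x ^+ (k * k1.+1)).
    by rewrite mulfVK ?expf_neq0 // exprVn mulVf // expf_neq0 // mulf_neq0 ?expf_neq0.
  have fxk j : finite_elt (x ^+ j).
    case: j => [|j]; first by rewrite expr0; exact: (unit1.1).
    by apply: infinitesimal_finite; exact: infX.
  apply: infinitesimalM; last by apply: finiteM => //; exact: (U.1).
  by rewrite -[n`!]prednK ?fact_gt0 //; exact: infX.
exists `|t|; split; first by rewrite normr_gt0.
- by move=> r r0; rewrite normr_id; exact: ti.
- by move=> z /tP[r zr]; exists r; move: zr; rewrite !normrM !normfV normr_id.
by move=> z; have [m [r zr]] := tM z; exists m, r; move: zr; rewrite !normrM !normrX normr_id.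
Qed.

Variables (F : {poly {poly R}}) (z : M).
Let G := map_poly (map_poly e) F.
Hypothesis rootF : G.[z%:P].[X] = 0.
Hypothesis simpleF : (map_poly (horner_eval X) G)^`().[z] != 0.

Section Uniformizer.
Variable t : M.
Hypothesis t0 : 0 < t.
Hypothesis ti : infinitesimal t.
Hypothesis tP : forall w, infinitesimal w -> finite_elt (w / t).
Hypothesis tM : forall w, exists m, finite_elt (w * t ^+ m).

(* [w] is the value at t of a Laurent polynomial whose real function is [g]; such values are dense
   in M, and their sign at t is the sign of [g] at some small positive real. *)
Definition laurent (g : R -> R) (w : M) := exists (P : {poly R}) D,
  w = (map_poly e P).[t] / t ^+ D /\ forall s, s != 0 -> g s = P.[s] / s ^+ D.

Lemma laurent_cst c : laurent (fun=> c) (e c).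
Proof.
exists c%:P, 0; rewrite map_polyC hornerC expr0 divr1; split => // s _.
by rewrite hornerC expr0 divr1.
Qed.

Lemma laurentD g h u v : laurent g u -> laurent h v -> laurent (fun s => g s + h s) (u + v).
Proof.
move=> [P [D [-> gP]]] [Q [E [-> hQ]]].
exists (P * 'X^E + Q * 'X^D), (D + E); split => [|s s0].
  rewrite rmorphD !rmorphM /= !map_polyXn !hornerE exprD.
  by field; rewrite !expf_neq0 ?lt0r_neq0.
rewrite gP // hQ // !hornerE exprD.
by field; rewrite !expf_neq0.
Qed.

Lemma laurentM g h u v : laurent g u -> laurent h v -> laurent (fun s => g s * h s) (u * v).
Proof.
move=> [P [D [-> gP]]] [Q [E [-> hQ]]].
exists (P * Q), (D + E); split => [|s s0].
  by rewrite rmorphM /= hornerM exprD mulf_div.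
by rewrite gP // hQ // hornerM exprD mulf_div.
Qed.

Lemma laurent_horner2 g h u v (H : {poly {poly R}}) : laurent g u -> laurent h v ->
  laurent (fun s => H.[(h s)%:P].[g s]) (map_poly (map_poly e) H).[v%:P].[u].
Proof.
move=> gu hv.
have L1 (q : {poly R}) : laurent (fun s => q.[g s]) (map_poly e q).[u].
  elim/poly_ind: q => [|q c IHq].
    have := laurent_cst 0; rewrite !rmorph0 horner0.
    by move=> [P [D [-> gP]]]; exists P, D; split => // s s0; rewrite -gP // horner0.
  have [P [D [E gP]]] := laurentD (laurentM IHq gu) (laurent_cst c).
  exists P, D; split; first by rewrite rmorphD rmorphM /= map_polyX map_polyC !hornerE.
  by move=> s s0; rewrite !hornerE gP.
elim/poly_ind: H => [|H q IHH].
  have := laurent_cst 0; rewrite !rmorph0 !horner0.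
  by move=> [P [D [-> gP]]]; exists P, D; split => // s s0; rewrite -gP // !horner0.
have [P [D [E gP]]] := laurentD (laurentM IHH hv) (L1 q).
exists P, D; split; first by rewrite rmorphD rmorphM /= map_polyX map_polyC !hornerE.
by move=> s s0; rewrite !hornerE gP.
Qed.

(** At a positive infinitesimal, as at small positive reals, the lowest nonzero coefficient of [P]
    decides the sign. *)
Lemma laurent_lt0 g w : laurent g w -> w < 0 -> exists s, g s < 0.
Proof.
move=> [P [D [-> gP]]]; rewrite pmulr_llt0 ?invr_gt0 ?exprn_gt0 // => Pt.
suff [s s0 Ps] : exists2 s : R, 0 < s & P.[s] < 0.
  by exists s; rewrite gP ?lt0r_neq0 // pmulr_llt0 // invr_gt0 exprn_gt0.
elim/poly_ind: P Pt {gP} => [|P c IHP]; first by rewrite rmorph0 horner0 ltxx.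
rewrite rmorphD rmorphM /= map_polyX map_polyC !hornerE => Pt.
have [c0|c0|c0] := ltgtP c 0.
- have [|d d0 dP] := @poly_lt0_near R (P * 'X + c%:P) 0; first by rewrite !hornerE.
  exists (d / 2); first by rewrite divr_gt0.
  by apply: dP; rewrite subr0 ger0_norm; lra.
- have fP : finite_elt (map_poly e P).[t].
    elim/poly_ind: (P) => [|p b pf]; first by rewrite rmorph0 horner0 -(rmorph0 e); exact: finite_emb.
    rewrite rmorphD rmorphM /= map_polyX map_polyC !hornerE.
    apply: finiteD; last exact: finite_emb.
    by apply: finiteM => //; exact: infinitesimal_finite.
  have := infinitesimalM ti fP c0; rewrite mulrC ler_norml => /andP[+ _].
  by rewrite -subr_ge0 opprK leNgt Pt.
- have ec : e c = 0 by apply/eqP; rewrite fmorph_eq0 c0.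
  have : (map_poly e P).[t] * t < 0.
    by rewrite -[X in X < 0]addr0 -[X in _ + X]ec; exact: Pt.
  rewrite pmulr_llt0 // => /IHP[s s0 Ps].
  by exists s => //; rewrite !hornerE ?c0 ?addr0 pmulr_llt0.
Qed.

(** Repeatedly subtracting the standard part and dividing by [t] expands a finite element in powers
    of [t] to any order. *)
Lemma laurent_dense w d : 0 < d -> exists g u, laurent g u /\ `|u - w| < d.
Proof.
move=> d0.
have expansion y N : finite_elt y -> exists (A : {poly R}) (b : M),
    finite_elt b /\ y = (map_poly e A).[t] + t ^+ N * b.
  elim: N y => [|N IHN] y fy.
    by exists 0, y; rewrite rmorph0 horner0 add0r expr0 mul1r.
  have [c /tP/IHN[A [b [fb E]]]] := residue fy.
  exists (A * 'X + c%:P), b; split => //.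
  rewrite rmorphD rmorphM /= map_polyX map_polyC !hornerE exprS.
  rewrite -[y](subrK (e c)) -[y - e c](mulfVK (lt0r_neq0 t0)) E; ring.
(* [m] clears the pole of [w]. Since [t^k / d] is finite, an error [t^(k+1) b] with [b] finite is
   infinitesimal compared with [d]. *)
have [m fm] := tM w; have [k fk] := tM d^-1.
have [A [b [fb E]]] := expansion _ (m + k.+1)%N fm.
exists (fun s => A.[s] / s ^+ m), ((map_poly e A).[t] / t ^+ m); split; first by exists A, m.
have tm0 : t ^+ m != 0 by rewrite expf_neq0 // lt0r_neq0.
have -> : (map_poly e A).[t] / t ^+ m - w = - (t * (t ^+ k * b)).
  have -> : w = ((map_poly e A).[t] + t ^+ (m + k.+1) * b) / t ^+ m by rewrite -E mulfK.
  by rewrite exprD exprS; field.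
have h : infinitesimal (t * (t ^+ k * b) * d^-1).
  have -> : t * (t ^+ k * b) * d^-1 = t * (d^-1 * t ^+ k * b) by ring.
  by apply: infinitesimalM => //; exact: finiteM.
have := h 2^-1; rewrite invr_gt0 ltr0n => /(_ isT).
rewrite normrM normfV [`|d|]gtr0_norm // ler_pdivrMr // normrN => /le_lt_trans; apply.
rewrite fmorphV rmorph_nat; lra.
Qed.

(** [G(X, .)] changes sign at its simple root [z], so it is negative at some [v] in [M]. Replacing
    [X], then [v], by nearby Laurent values keeps the sign, which passes to a real parameter [s]. *)
Lemma negative_value_of_simple_root : exists x y, F.[y%:P].[x] < 0.
Proof.
have xE u v : G.[v%:P].[u] = (map_poly (horner_eval u) G).[v].
  by rewrite -[v in RHS](hornerC v u) -/(horner_eval u _) horner_map.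
have [v Gv] : exists v, G.[v%:P].[X] < 0.
  pose g := map_poly (horner_eval X) G; have sg : g^`().[z] != 0 := simpleF.
  have /factor_theorem[h gh] : root g z by rewrite /root -xE rootF.
  have hz : h.[z] != 0.
    by move: sg; rewrite gh derivM derivXsubC !hornerE subrr mulr0 add0r.
  have [h0|h0|h0] := ltgtP h.[z] 0; last by rewrite h0 eqxx in hz.
    have [d d0 dP] := poly_lt0_near h0.
    exists (z + d / 2); rewrite xE -/g gh hornerM hornerXsubC.
    have := dP (z + d / 2); rewrite addrAC subrr add0r gtr0_norm; last lra.
    move=> /(_ ltac:(lra)) hh; rewrite nmulr_rlt0 //; lra.
  have [|d d0 dP] := @poly_lt0_near M (- h) z; first by rewrite hornerN oppr_lt0.
  exists (z - d / 2); rewrite xE -/g gh hornerM hornerXsubC.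
  have := dP (z - d / 2); rewrite addrAC subrr add0r normrN gtr0_norm; last lra.
  rewrite hornerN oppr_lt0.
  move=> /(_ ltac:(lra)) hh; rewrite pmulr_rlt0 //; lra.
have [d d0 dP] := poly_lt0_near Gv.
have [g [u [gu ud]]] := laurent_dense X d0.
have := dP _ ud; rewrite xE => Gu.
have [d' d0' dP'] := poly_lt0_near Gu.
have [h [v' [hv vd]]] := laurent_dense v d0'.
have := dP' _ vd; rewrite -xE => /(laurent_lt0 (laurent_horner2 F gu hv))[s Fs].
by exists (g s), (h s).
Qed.
End Uniformizer.

Lemma negative_value : exists x y, F.[y%:P].[x] < 0.
Proof.
by have [t [t0 ti tP tM]] := uniformizer; exact: negative_value_of_simple_root t0 ti tP tM.
Qed.
End Transcendental.
End Infinitesimals.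

(** * Sums of squares in K(y) *)

Definition anisotropic (A : nzRingType) :=
  forall s : seq A, \sum_(g <- s) g ^+ 2 = 0 -> forall g, g \in s -> g = 0.

Lemma anisotropic_real (A : realDomainType) : anisotropic A.
Proof.
move=> s /eqP; rewrite psumr_eq0 => [/allP h g /h|g _]; last exact: sqr_ge0.
by rewrite implyTb sqrf_eq0 => /eqP.
Qed.

(** The squares of the constant terms sum to 0, so every constant term is 0; cancelling ['X ^+ 2]
    then lowers the degrees. *)
Lemma anisotropic_poly (A : comNzRingType) : anisotropic A -> anisotropic {poly A}.
Proof.
move=> anA s; have : forall g, g \in s -> (size g <= \max_(g <- s) size g)%N.
  by move=> g gs; rewrite (big_rem g) //= leq_maxl.
move: (\max_(g <- s) size g)%N => N; elim: N s => [|n IHn] s sz s0 g gs.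
  by apply/eqP; rewrite -size_poly_leq0 sz.
have c0 h : h \in s -> h.[0] = 0.
  move=> hs; apply: (anA [seq g.[0] | g <- s]); last exact: map_f.
  rewrite big_map; have := congr1 (horner_eval 0) s0.
  rewrite rmorph_sum rmorph0 => E; rewrite -[RHS]E; apply: eq_bigr => i _.
  by rewrite rmorphXn.
have dE h : h \in s -> h = drop_poly 1 h * 'X.
  move=> /c0 h0; rewrite -[LHS](poly_take_drop 1 h) expr1.
  suff -> : take_poly 1 h = 0 by rewrite add0r.
  apply/polyP => -[|i]; rewrite coef_take_poly coef0 //=.
  by rewrite -horner_coef0.
suff d0 : drop_poly 1 g = 0 by rewrite (dE g gs) d0 mul0r.
apply: (IHn [seq drop_poly 1 g | g <- s]); last exact: map_f.
  by move=> _ /mapP[h hs ->]; rewrite size_drop_poly leq_subLR add1n sz.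
apply/(@lreg_lead _ ('X ^+ 2)); first by rewrite lead_coefXn; exact: lreg1.
rewrite mulr0 big_map big_distrr -[RHS]s0 /=; apply: eq_big_seq => h hs.
by rewrite [in RHS](dE h hs) exprMn mulrC.
Qed.

Section Cassels.
Variable K : fieldType.
Hypothesis anisoK : anisotropic {poly K}.
Implicit Types f g p q : {poly K}.

Lemma sum_sqr_lin (A : comNzRingType) (I : Type) (s : seq I) (x y : A) (a b : I -> A) :
  \sum_(i <- s) (x * a i + y * b i) ^+ 2 = x ^+ 2 * (\sum_(i <- s) a i ^+ 2)
    + x * y * (\sum_(i <- s) a i * b i) *+ 2 + y ^+ 2 * (\sum_(i <- s) b i ^+ 2).
Proof.
rewrite !big_distrr /= -sumrMnl -!big_split /=; apply: eq_bigr => i _; ring.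
Qed.

(* Cassels: if the numerators a_i reduce mod g to r_i = a_i - g b_i, the second intersection
   with the sphere of the line through (a_i / g) and (b_i) has a denominator dividing
   (sum r_i^2) / g, of lower degree than g. *)
Lemma sos_cancel_denominator f g : g != 0 -> is_sos (f * g ^+ 2) -> is_sos f.
Proof.
elim: {g}(size g) {-2}g (leqnn (size g)) => [|n IHn] g.
  by rewrite leqn0 size_poly_eq0 => ->.
move=> sg g0 [s fg].
pose r p := p %% g; pose b p := p %/ g.
have pE p : p = g * b p + r p by rewrite mulrC -divp_eq.
pose Sa := \sum_(p <- s) p ^+ 2; pose Sb := \sum_(p <- s) b p ^+ 2.
pose Sab := \sum_(p <- s) p * b p; pose Sr := \sum_(p <- s) r p ^+ 2.
have SrE : Sr = Sa - g * Sab *+ 2 + g ^+ 2 * Sb.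
  have := sum_sqr_lin s 1 (- g) id b; rewrite -/Sa -/Sb -/Sab => E.
  have -> : Sa - g * Sab *+ 2 + g ^+ 2 * Sb
    = 1 ^+ 2 * Sa + 1 * - g * Sab *+ 2 + (- g) ^+ 2 * Sb by ring.
  rewrite -E; apply: eq_bigr => p _; congr (_ ^+ 2).
  by move: (pE p) => /=; move: (b p) (r p) => B C ->; ring.
pose u := Sab - f * g; pose be := Sb - f; pose g' := be * g - u *+ 2.
have SaE : Sa = f * g ^+ 2 by [].
have gg' : g * g' = Sr by rewrite SrE SaE /g' /be /u; ring.
have [Sr0|Sr0] := eqVneq Sr 0.
  exists [seq b p | p <- s]; rewrite big_map.
  apply: (mulIf (expf_neq0 2 g0)); rewrite -/Sb -SaE /Sb big_distrl /=.
  apply: eq_big_seq => p ps.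
  have rp0 : r p = 0.
    by apply: (anisoK (s := [seq r p | p <- s])); [rewrite big_map | exact: map_f].
  by rewrite {1}(pE p) rp0 addr0 exprMn mulrC.
have g'0 : g' != 0 by apply: contra_neq Sr0 => h; rewrite -gg' h mulr0.
apply: (IHn g') => //; last first.
  (* After substituting [Sab = u + f g] and [Sb = be + f], the terms in [be u^2] cancel and
     [f (be g - 2 u)^2] remains. *)
  exists [seq be * p + (- (u *+ 2)) * b p | p <- s].
  rewrite big_map sum_sqr_lin -/Sa -/Sb -/Sab SaE /g'.
  have -> : Sab = u + f * g by rewrite /u subrK.
  have -> : Sb = be + f by rewrite /be subrK.
  ring.
have sr p : (size (r p) < size g)%N by rewrite ltn_modp.
have sSr : (size Sr <= ((size g).-1 * 2).-1)%N.
  rewrite (leq_trans (size_sum _ _ _)) //; apply/bigmax_leqP_seq => p _ _.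
  rewrite expr2 (leq_trans (size_polyMleq _ _)) //.
  by have := sr p; move: (size (r p)) (size g) => m k; lia.
move: sSr; rewrite -gg' size_mul // => h.
have gp : (0 < size g)%N by rewrite size_poly_gt0.
have g'p : (0 < size g')%N by rewrite size_poly_gt0.
rewrite -ltnS (leq_trans _ sg) //.
by move: h gp g'p; move: (size g) (size g') => m k; lia.
Qed.
End Cassels.

(* Elements of {poly {poly R}} are polynomials in y (outer) over R[x] (inner): F.[y%:P].[x] is
   F(x, y). *)
Definition psd2 (R : realType) (F : {poly {poly R}}) := forall x y, 0 <= F.[y%:P].[x].

Lemma horner2E (A : comNzRingType) (F : {poly {poly A}}) (x y : A) :
  F.[y%:P].[x] = (map_poly (horner_eval x) F).[y].
Proof. by rewrite -[y in RHS](hornerC y x) -/(horner_eval x _) horner_map. Qed.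

(** A negative value persists nearby: [x] is moved off the zeros of the leading coefficient of [D],
    then [y] off those of [D(x', .)]. *)
Lemma psd2_dense (R : realType) (F D : {poly {poly R}}) : D != 0 ->
  (forall x y, D.[y%:P].[x] != 0 -> 0 <= F.[y%:P].[x]) -> psd2 F.
Proof.
move=> D0 FD x y; rewrite leNgt; apply/negP => Fxy.
have lD0 : lead_coef D != 0 by rewrite lead_coef_eq0.
have [x' [Fx' Dx']] := poly_avoid Fxy lD0.
have D'0 : map_poly (horner_eval x') D != 0.
  apply/eqP => /polyP /(_ (size D).-1); rewrite coef_map coef0 -lead_coefE => /eqP.
  by rewrite /= /horner_eval (negPf Dx').
rewrite horner2E in Fx'; have [y' [Fy' Dy']] := poly_avoid Fx' D'0.
by have := FD x' y'; rewrite !horner2E => /(_ Dy'); rewrite leNgt Fy'.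
Qed.

Lemma rootless_gt0 (R : rcfType) (p : {poly R}) :
  0 < lead_coef p -> (forall x, p.[x] != 0) -> forall x, 0 < p.[x].
Proof.
move=> /[dup] lp /poly_pinfty_gt_lc[n nP] px x; rewrite lt_neqAle eq_sym px /= leNgt.
apply/negP => pneg; pose m := Num.max x n.
have pm : 0 < p.[m] by rewrite (lt_le_trans lp) // nP // le_max lexx orbT.
have xm : x <= m by rewrite le_max lexx.
have [|z _ /rootP pz] := @Num.Theory.poly_ivt R p x m xm; first by rewrite !ltW.
by have := px z; rewrite pz eqxx.
Qed.

(** * Clearing denominators and nonnegativity over R(x) *)

Section Fractions.
Variables (R : realType) (K : fieldType) (tau : {rmorphism {poly R} -> K}).
Hypothesis tau_inj : injective tau.
Hypothesis tau_frac : forall x, exists a b, b != 0 /\ x = tau a / tau b.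

Let tau_eq0 a : (tau a == 0) = (a == 0).
Proof. by rewrite -(rmorph0 tau) (inj_eq tau_inj). Qed.

Local Notation lift := (map_poly tau).

Lemma lift_poly_inj : injective lift.
Proof. exact: map_inj_poly tau_inj (rmorph0 tau). Qed.

Lemma size_lift_poly F : size (lift F) = size F.
Proof. by rewrite size_map_inj_poly // rmorph0. Qed.

Lemma lift_poly_mulC c F : lift (c%:P * F) = tau c *: lift F.
Proof. by rewrite (rmorphM (map_poly tau)) /= map_polyC mul_polyC. Qed.

Lemma clear_denominators (q : {poly K}) :
  exists d Q, d != 0 /\ lift Q = tau d *: q.
Proof.
elim/poly_ind: q => [|q c [d [Q [d0 QE]]]].
  by exists 1, 0; rewrite oner_neq0 rmorph0 scaler0.
have [a [b [b0 cE]]] := tau_frac c.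
exists (b * d), (b%:P * Q * 'X + (a * d)%:P); split; first by rewrite mulf_neq0.
have bc : tau b * c = tau a by rewrite cE mulrC divfK // tau_eq0.
rewrite rmorphD !rmorphM /= map_polyX !map_polyC /= QE -!mul_polyC -bc !rmorphM /=.
ring.
Qed.

Lemma clear_denominators_seq (s : seq {poly K}) :
  exists d S, d != 0 /\ [seq lift Q | Q <- S] = [seq tau d *: q | q <- s].
Proof.
elim: s => [|q s [d [S [d0 SE]]]]; first by exists 1, [::]; rewrite oner_neq0.
have [c [Q [c0 QE]]] := clear_denominators q.
exists (c * d), (d%:P * Q :: [seq c%:P * P | P <- S]); split; first by rewrite mulf_neq0.
rewrite /= lift_poly_mulC QE scalerA -rmorphM mulrC; congr (_ :: _).
rewrite -map_comp (eq_map (g := fun P => tau c *: lift P)); last first.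
  by move=> P /=; exact: lift_poly_mulC.
rewrite (map_comp (fun q => tau c *: q) lift) SE -map_comp; apply: eq_map => p /=.
by rewrite scalerA -rmorphM mulrC.
Qed.

Lemma anisotropic_fractions : anisotropic K.
Proof.
have anR : anisotropic {poly R} by apply: anisotropic_poly; exact: anisotropic_real.
move=> s s0 g gs.
have [d [S [d0 SE]]] := clear_denominators_seq [seq c%:P | c <- s].
have : \sum_(P <- S) P ^+ 2 = 0.
  apply: lift_poly_inj; rewrite rmorph_sum rmorph0 /=.
  rewrite (eq_bigr (fun P => (lift P) ^+ 2)); last by move=> P _; rewrite rmorphXn.
  rewrite -(big_map lift xpredT (fun q => q ^+ 2)) SE -map_comp big_map /=.
  rewrite (eq_bigr (fun c => (tau d ^+ 2 * c ^+ 2)%:P)); last first.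
    by move=> c _; rewrite -mul_polyC -polyCM -polyC_exp exprMn.
  by rewrite -rmorph_sum -big_distrr /= s0 mulr0 rmorph0.
move/(anisotropic_poly anR) => S0.
have : tau d *: g%:P \in [seq tau d *: q | q <- [seq c%:P | c <- s]].
  by apply: map_f; exact: map_f.
rewrite -SE => /mapP[P /S0 -> /eqP]; rewrite rmorph0 scaler_eq0 tau_eq0 (negPf d0).
by rewrite polyC_eq0 => /eqP.
Qed.

(** Clearing denominators by a square keeps the sign, so nonnegativity is tested on a polynomial
    multiple. *)
Definition psdK (q : {poly K}) :=
  exists d Q, [/\ d != 0, lift Q = tau (d ^+ 2) *: q & psd2 Q].

Lemma psdK_clear (q : {poly K}) : exists d Q, d != 0 /\ lift Q = tau (d ^+ 2) *: q.
Proof.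
have [d [Q [d0 QE]]] := clear_denominators q.
exists d, (d%:P * Q); split => //.
by rewrite lift_poly_mulC QE scalerA -rmorphM expr2.
Qed.

Lemma psdK_lift (F : {poly {poly R}}) : psd2 F -> psdK (lift F).
Proof. by move=> Fp; exists 1, F; rewrite expr1n rmorph1 scale1r oner_neq0. Qed.

Lemma sos_psd2 (F : {poly {poly R}}) : is_sos F -> psd2 F.
Proof.
move=> sF x y; have /sos_ge0 := sos_rmorph (horner_eval x) (sos_rmorph (horner_eval y%:P) sF).
by [].
Qed.

Lemma sos_psdK (q : {poly K}) : is_sos q -> psdK q.
Proof.
move=> [s ->] {q}; have [d [S [d0 SE]]] := clear_denominators_seq s.
exists d, (\sum_(P <- S) P ^+ 2); split => //; last by apply: sos_psd2; exists S.
rewrite rmorph_sum /= (eq_bigr (fun P => (lift P) ^+ 2)); last by move=> P _; rewrite rmorphXn.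
rewrite -(big_map lift xpredT (fun q => q ^+ 2)) SE big_map scaler_sumr.
by apply: eq_bigr => p _; rewrite exprZn rmorphXn.
Qed.

Lemma psdK_div (q h : {poly K}) : h != 0 -> psdK (q * h) -> psdK h -> psdK q.
Proof.
move=> h0 [w [W [w0 WE Wp]]] [c [H [c0 HE Hp]]].
have [d [Q [d0 QE]]] := psdK_clear q.
exists d, Q; split => //.
have E : (w ^+ 2)%:P * Q * H = ((c * d) ^+ 2)%:P * W.
  apply: lift_poly_inj; rewrite (rmorphM lift) /= !lift_poly_mulC QE HE WE -!scalerAl -!scalerAr.
  by rewrite !scalerA -!rmorphM; congr (tau _ *: _); ring.
have H0 : H != 0.
  apply: contra_neq h0 => H0; move/eqP: HE; rewrite H0 rmorph0 eq_sym scaler_eq0.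
  by rewrite tau_eq0 expf_eq0 (negPf c0) => /eqP.
have w0' : w%:P != 0 :> {poly {poly R}} by rewrite polyC_eq0.
have wH : w%:P * H != 0 by exact: mulf_neq0 w0' H0.
apply: (psd2_dense wH).
move=> x y; rewrite !hornerM !hornerC mulf_eq0 negb_or => /andP[wx Hxy].
have := congr1 (fun P => P.[y%:P].[x]) E.
rewrite /= !hornerM !hornerC !horner_exp => E'.
have H_gt0 : 0 < H.[y%:P].[x] by rewrite lt_neqAle eq_sym Hxy; exact: Hp.
have w_gt0 : 0 < w.[x] ^+ 2 by rewrite exprn_even_gt0.
rewrite -(pmulr_rge0 _ w_gt0) -(pmulr_lge0 _ H_gt0) E'.
by rewrite mulr_ge0 ?sqr_ge0 //; exact: Wp.
Qed.

(** Where the denominators do not vanish, [p g >= 1] leaves [p(x, .)] without real zeros. Its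
    leading coefficient is positive, so the intermediate value theorem fixes the sign, and density
    does the rest. *)
Lemma psdK_of_rootless (p g : {poly K}) : p \is monic -> psdK (p * g - 1) -> psdK p.
Proof.
move=> pm [w [W [w0 WE Wp]]].
have [c [P [c0 PE]]] := psdK_clear p; have [d [G [d0 GE]]] := psdK_clear g.
exists c, P; split => //.
have E : (w ^+ 2)%:P * P * G = ((c * d) ^+ 2)%:P * (W + (w ^+ 2)%:P).
  apply: lift_poly_inj; rewrite (rmorphM lift) /= !lift_poly_mulC rmorphD /= map_polyC /= PE GE WE.
  rewrite scalerBr -[tau _ *: 1]mul_polyC mulr1 subrK -!scalerAl -!scalerAr.
  by rewrite !scalerA -!rmorphM; congr (tau _ *: _); ring.
have lP : lead_coef P = c ^+ 2.
  apply: tau_inj; rewrite -lead_coef_map_inj ?rmorph0 // PE lead_coefZ (monicP pm).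
  exact: mulr1.
have wcd : w * c * d != 0 by rewrite !mulf_neq0.
apply: (@psd2_dense _ _ (w * c * d)%:P); first by rewrite polyC_eq0.
move=> x y; rewrite hornerC !hornerM !mulf_eq0 !negb_or => /andP[/andP[wx cx] dx].
rewrite horner2E; apply/ltW/rootless_gt0.
  rewrite lead_coef_map_eq ?lP /= /horner_eval horner_exp ?exprn_even_gt0 //.
  by rewrite expf_neq0.
move=> z; rewrite -horner2E; apply/eqP => Pz.
have cd : ((c * d) ^+ 2).[x] != 0 by rewrite horner_exp hornerM expf_neq0 // mulf_neq0.
have ww : 0 < (w ^+ 2).[x] by rewrite horner_exp exprn_even_gt0.
have := congr1 (fun P => P.[z%:P].[x]) E.
move: ((c * d) ^+ 2) (w ^+ 2) cd ww => e v e0 v0.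
rewrite /= !hornerM Pz mulr0 mul0r !hornerC !hornerD !hornerC => /esym/eqP.
rewrite mulf_eq0 (negPf e0) /=; apply/negP; rewrite gt_eqF // ltr_wpDl //; exact: Wp.
Qed.
End Fractions.

(** * Nonnegative polynomials over R(x) *)

Section Hilbert17.
Variables (R : realType) (K : fieldType) (tau : {rmorphism {poly R} -> K}).
Hypothesis tau_inj : injective tau.
Hypothesis tau_frac : forall x, exists a b, b != 0 /\ x = tau a / tau b.
Local Notation lift := (map_poly tau).

Let tau0 a : (tau a == 0) = (a == 0).
Proof. by rewrite -(rmorph0 tau) (inj_eq tau_inj). Qed.

Lemma irreducible_deriv_nondvd (p : {poly K}) : irreducible_poly p -> ~~ (p %| p^`()).
Proof.
move=> irrp; have p0 := irredp_neq0 irrp; have [p1 _] := irrp.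
apply/negP => pp'.
have K0 n : (n.+1%:R : K) != 0.
  rewrite -(rmorph_nat tau) -(rmorph0 tau) (inj_eq tau_inj) -polyC_natr polyC_eq0.
  by rewrite pnatr_eq0.
have p'0 : p^`() != 0.
  apply/eqP => /polyP /(_ (size p).-2); rewrite coef_deriv coef0.
  have -> : (size p).-2.+1 = (size p).-1 by move: p1; case: (size p) => [|[]].
  rewrite -lead_coefE -mulr_natr => /eqP; rewrite mulf_eq0 lead_coef_eq0 (negPf p0) /=.
  by move: p1; case: (size p) => [|[|n]] //= _; rewrite (negPf (K0 _)).
have := dvdp_leq p'0 pp'; rewrite leqNgt.
by rewrite (leq_ltn_trans (size_poly _ _)) // ltn_predL (ltn_trans _ p1).
Qed.

Lemma irreducible_root_dvdp (L : fieldType) (f : {rmorphism K -> L}) (p h : {poly K}) (z : L) :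
  irreducible_poly p -> root (map_poly f p) z -> root (map_poly f h) z = (p %| h).
Proof.
move=> irrp pz; apply/idP/idP => [hz|/dvdpP[q ->]]; last first.
  by rewrite rmorphM rootM pz orbT.
apply: contraLR hz; rewrite -(irreducible_poly_coprime _ irrp) => /Bezout_eq1_coprimepP[[u v] /= E].
apply/negP => hz; have := congr1 (fun q => (map_poly f q).[z]) E.
rewrite /= rmorphD !rmorphM rmorph1 /= !hornerE (rootP pz) (rootP hz) !mulr0 addr0.
by move/esym/eqP; rewrite oner_eq0.
Qed.

(** The condition on [p] says that -1 is not a sum of squares in [K[y]/(p)], which can therefore be
    ordered. The class of y is a root of [F] there, simple because [p] divides neither [q] nor its
    own derivative. *)
Lemma negative_value_of_formally_real (p q : {poly K}) (F : {poly {poly R}}) :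
    irreducible_poly p -> (forall s : seq {poly K}, ~~ (p %| 1 + \sum_(g <- s) g ^+ 2)) ->
    lift F = p * q -> ~~ (p %| q) ->
  exists x y, F.[y%:P].[x] < 0.
Proof.
move=> irrp real_p FE pq.
have [L dimL [z pz zL]] := irredp_FAdjoin irrp.
have [|M [f fsurj]] := @formally_real_order L.
  move=> [s sN1].
  have [t tE] : exists t : seq {poly K}, s = [seq (map_poly (in_alg L) g).[z] | g <- t].
    elim: (s) => [|a s' [t ->]]; first by exists [::].
    have /Fadjoin1_polyP[g ->] : a \in <<1; z>>%VS by rewrite zL memvf.
    by exists (g :: t).
  have := real_p t; rewrite -(irreducible_root_dvdp _ irrp pz) => /negP; apply.
  rewrite /root rmorphD rmorph1 rmorph_sum /= hornerD hornerC horner_sum.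
  rewrite (eq_bigr (fun g => (map_poly (in_alg L) g).[z] ^+ 2)); last first.
    by move=> g _; rewrite rmorphXn /= horner_exp.
  by rewrite -(big_map _ xpredT (fun a => a ^+ 2)) -tE -sN1 addrN.
pose j : {rmorphism {poly R} -> M} := f \o (in_alg L) \o tau.
pose e : {rmorphism R -> M} := j \o polyC.
pose X := j 'X.
have aE (r : {poly R}) : (map_poly e r).[X] = j r.
  elim/poly_ind: r => [|r c IH]; first by rewrite !rmorph0 horner0.
  rewrite [in RHS]rmorphD [in RHS]rmorphM -IH -/X.
  by rewrite rmorphD rmorphM /= map_polyX map_polyC !hornerE.
have j0 r : r != 0 -> j r != 0.
  move=> r0; rewrite -[j r]/(f (in_alg L (tau r))) fmorph_eq0.
  by rewrite (fmorph_eq0 (in_alg L)) tau0.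
have GE : map_poly (horner_eval X) (map_poly (map_poly e) F)
    = map_poly f (map_poly (in_alg L) (p * q)).
  apply/polyP => i; rewrite -FE !coef_map.
  exact: aE.
apply: (@negative_value R M e X _ (\dim {:L}) _ F (f z)).
- by move=> r r0; rewrite aE j0.
(* A minimal polynomial over [K], cleared of denominators, is a relation over R[x] of degree at most
   the dimension of [L]. *)
- move=> w; have [l <-] := fsurj w.
  have /polyOver1P[m mE] := minPolyOver 1 l.
  have m0 : m != 0.
    apply/eqP => m0; have := monic_minPoly 1 l.
    by rewrite mE m0 rmorph0 monicE lead_coef0 eq_sym oner_eq0.
  have sm : (size m <= (\dim {:L}).+1)%N.
    rewrite -(size_map_poly (in_alg L)) -mE size_minPoly ltnS.
    have := dim_Fadjoin 1 l; rewrite dimv1 muln1 => <-.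
    exact/dimvS/subvf.
  have [d [Q [d0 QE]]] := clear_denominators tau_inj tau_frac m.
  have sQ : size Q = size m.
    by rewrite -(size_lift_poly tau_inj) QE size_scale // tau0.
  exists Q; split; [by rewrite -size_poly_eq0 sQ size_poly_eq0| by rewrite sQ|].
  under eq_bigr do rewrite aE.
  have : (map_poly j Q).[f l] = 0.
    rewrite -[map_poly j Q]/(map_poly ((f \o in_alg L) \o tau) Q) map_poly_comp.
    rewrite QE map_polyZ hornerZ map_poly_comp horner_map -mE.
    by rewrite minPolyxx rmorph0 mulr0.
  rewrite (@horner_coef_wide _ (\dim {:L}).+1) ?(leq_trans (size_poly _ _)) ?sQ //.
  by move=> E; rewrite -[RHS]E; apply: eq_bigr => i _; rewrite (coef_map j).
- rewrite horner2E GE horner_map rmorphM /= hornerM (rootP pz) mul0r.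
  exact: rmorph0.
- rewrite GE deriv_map horner_map fmorph_eq0 deriv_map derivM rmorphD !rmorphM /=.
  rewrite hornerD !hornerM (rootP pz) mul0r addr0 mulf_neq0 //.
    have := irreducible_root_dvdp p^`() irrp pz; rewrite /root => ->.
    exact: irreducible_deriv_nondvd.
  by have := irreducible_root_dvdp q irrp pz; rewrite /root => ->.
Qed.

Lemma irreducible_divisor (k : fieldType) (q : {poly k}) : (1 < size q)%N ->
  exists2 p, irreducible_poly p & p \is monic /\ p %| q.
Proof.
elim: {q}(size q) {-2}q (leqnn (size q)) => [|n IHn] q sq q1.
  by move: q1; rewrite ltnNge (leq_trans sq).
have q0 : q != 0 by rewrite -size_poly_gt0 (ltn_trans _ q1).
have [irr|nirr] := pselect (irreducible_poly q).
  have lq : lead_coef q != 0 by rewrite lead_coef_eq0.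
  exists ((lead_coef q)^-1 *: q); last first.
    by rewrite monicE lead_coefZ mulVf // dvdpZl ?invr_eq0.
  split; first by rewrite size_scale ?invr_eq0.
  move=> r r1; rewrite dvdpZr ?invr_eq0 // => rq.
  by rewrite (eqp_trans (irr.2 r r1 rq)) // eqp_sym eqp_scale ?invr_eq0.
have [r [r1 rq nrq]] : exists r : {poly k}, [/\ size r != 1%N, r %| q & ~~ (r %= q)].
  apply: contrapT => none; apply: nirr; split => // r r1 rq.
  by apply/negPn/negP => nrq; apply: none; exists r.
have r0 : r != 0 by apply: contraTneq rq => ->; rewrite dvd0p.
have srq : (size r < size q)%N.
  by rewrite ltn_neqAle dvdp_leq // andbT (dvdp_size_eqp rq).
have [||p irrp [pm pr]] := IHn r.
- by rewrite -ltnS (leq_trans srq).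
- by move: r1; rewrite -size_poly_gt0 in r0; case: (size r) r0 => [|[]].
by exists p => //; split=> //; exact: dvdp_trans rq.
Qed.

Let anisoKX : anisotropic {poly K}.
Proof. exact/anisotropic_poly/(anisotropic_fractions tau_inj tau_frac). Qed.

Lemma psdK_sos (q : {poly K}) : psdK tau q -> is_sos q.
Proof.
elim: {q}(size q) {-2}q (leqnn (size q)) => [|n IHn] q sq qpsd.
  by move: sq; rewrite leqn0 size_poly_eq0 => /eqP->; exact: sos0.
have [q0|q0] := eqVneq q 0; first by rewrite q0; exact: sos0.
have descale d Q : d != 0 -> lift Q = tau (d ^+ 2) *: q -> is_sos Q -> is_sos q.
  move=> d0 QE /(sos_rmorph (map_poly tau)); rewrite /= QE => sQ.
  have -> : q = ((tau d)^-1%:P) ^+ 2 * (tau (d ^+ 2) *: q).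
    by rewrite -polyC_exp mul_polyC scalerA rmorphXn -exprMn mulVf ?tau0 // expr1n scale1r.
  exact: sos_sqrM.
have [q1|q1] := leqP (size q) 1.
  have [d [Q [d0 QE Qp]]] := qpsd; apply: (descale d Q d0 QE).
  have sQ : (size Q <= 1)%N.
    by rewrite -(size_lift_poly tau_inj) QE size_scale // tau0 expf_neq0.
  move: Qp; rewrite (size1_polyC sQ) => Qp.
  apply: (sos_rmorph polyC); apply: psd_sos => x.
  by have := Qp x 0; rewrite hornerC.
have [[g g1 /dvdpP[r qE]]|sqfree] := pselect (exists2 g : {poly K}, (1 < size g)%N & g ^+ 2 %| q).
  have g0 : g != 0 by rewrite -size_poly_gt0 (ltn_trans _ g1).
  have r0 : r != 0 by apply: contra_neq q0 => r0; rewrite qE r0 mul0r.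
  rewrite qE mulrC; apply: sos_sqrM; apply: IHn.
    move: sq g1; rewrite qE size_mul ?expf_neq0 // expr2 size_mul //.
    by move: (size g) (size r) => a b; lia.
  apply: (psdK_div tau_inj tau_frac (expf_neq0 2 g0)); first by rewrite -qE.
  by apply: (sos_psdK tau_inj tau_frac); exact: sos_sqr.
have [p irrp [pm /dvdpP[r qE]]] := irreducible_divisor q1.
have [p1 _] := irrp; have p0 := irredp_neq0 irrp.
have r0 : r != 0 by apply: contra_neq q0 => r0; rewrite qE r0 mul0r.
have pr : ~~ (p %| r).
  apply/negP => /dvdpP[u rE]; apply: sqfree; exists p => //.
  by rewrite qE rE -mulrA expr2 dvdp_mulIr.
have [[s sp]|real_p] := pselect (exists s : seq {poly K}, p %| 1 + \sum_(g <- s) g ^+ 2); last first.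
  have [d [Q [d0 QE Qp]]] := qpsd.
  have [|||x [y]] := @negative_value_of_formally_real p (tau (d ^+ 2) *: r) Q irrp.
  - by move=> s; apply/negP => sp; apply: real_p; exists s.
  - by rewrite QE qE mulrC -scalerAr mulrC.
  - by rewrite dvdpZr // tau0 expf_neq0.
  by rewrite ltNge Qp.
(* Reducing the squared terms modulo [p] gives [1 + S = g p] with [g] of lower degree than [p]. *)
have {s sp} [s ss /dvdpP[g sE]] : exists2 s : seq {poly K},
    (forall a, a \in s -> size a < size p)%N & p %| 1 + \sum_(a <- s) a ^+ 2.
  exists [seq a %% p | a <- s]; first by move=> _ /mapP[a _ ->]; rewrite ltn_modp.
  have -> : 1 + \sum_(a <- [seq a %% p | a <- s]) a ^+ 2 = 1 + \sum_(a <- s) a ^+ 2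
      - p * \sum_(a <- s) (a %/ p) * (a %% p *+ 2 + a %/ p * p).
    rewrite big_map -addrA; congr (_ + _); rewrite big_distrr /= -sumrB.
    by apply: eq_bigr => a _; rewrite [in a ^+ 2](divp_eq a p); ring.
  by rewrite dvdp_sub // dvdp_mulIl.
pose S := \sum_(a <- s) a ^+ 2.
have g0 : g != 0.
  apply/eqP => g0; have := anisoKX (s := 1 :: s); rewrite big_cons expr1n sE g0 mul0r.
  by move=> /(_ erefl 1 (mem_head _ _)) /eqP; rewrite oner_eq0.
have sg : (size g < size p)%N.
  have : (size (1 + S)%R <= ((size p).-1 * 2).-1)%N.
    rewrite (leq_trans (size_polyD _ _)) // geq_max size_poly1; apply/andP; split.
      by move: p1; move: (size p) => a; lia.
    rewrite (leq_trans (size_sum _ _ _)) //; apply/bigmax_leqP_seq => a /ss sa _.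
    rewrite expr2 (leq_trans (size_polyMleq _ _)) //.
    by move: sa; move: (size a) (size p) => i j; lia.
  rewrite sE size_mul //.
  have : (0 < size g)%N by rewrite size_poly_gt0.
  by move: p1; move: (size g) (size p) => a b; lia.
have psS : is_sos (1 + S) by apply: sosD; [exact: sos1 | exists s].
have pp : psdK tau p.
  apply: (psdK_of_rootless tau_inj tau_frac (g := g)) => //.
  by rewrite mulrC -sE addrC addKr; apply: (sos_psdK tau_inj tau_frac); exists s.
have gp : psdK tau g.
  apply: (psdK_div tau_inj tau_frac p0) => //.
  by rewrite -sE; exact: (sos_psdK tau_inj tau_frac).
have pq : (size p <= size q)%N by apply: dvdp_leq => //; rewrite qE dvdp_mulIr.
rewrite qE; apply: sosM.
  apply: IHn; last by apply: (psdK_div tau_inj tau_frac p0) => //; rewrite -qE.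
  by move: sq p1; rewrite qE size_mul //; move: (size p) (size r) => a b; lia.
(* [p] may have the degree of [q], out of reach of the induction, but [g] has lower degree:
   [p g^2 = (1 + S) g] is a sum of squares, and Cassels removes [g^2]. *)
apply: (sos_cancel_denominator anisoKX g0).
rewrite expr2 mulrA [p * g]mulrC -sE; apply: sosM => //.
apply: IHn => //; rewrite -ltnS (leq_trans sg) // (leq_trans pq) //.
Qed.
End Hilbert17.

(** * Denominators in R[x] *)

Lemma tofrac_inj (A : idomainType) : injective (@FracField.tofrac A).
Proof. by move=> x y /eqP; rewrite tofrac_eq => /eqP. Qed.

Lemma tofrac_fracP (A : idomainType) (x : {fraction A}) :
  exists a b, b != 0 /\ x = FracField.tofrac a / FracField.tofrac b.
Proof.
elim/quotW: x => x; exists \n_x, \d_x; split; first exact: denom_ratioP.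
have dx : FracField.tofrac \d_x != 0 by rewrite tofrac_eq0 denom_ratioP.
apply: (mulIf dx); rewrite divfK //.
unlock FracField.tofrac; rewrite -[LHS]FracField.pi_mul.
apply/eqmodP; rewrite /= FracField.equivfE /FracField.mulf !numden_Ratio ?mulr1 ?oner_eq0 ?denom_ratioP //.
by rewrite mulrC.
Qed.

Section RealFunctionField.
Variable R : realType.
Local Notation K := {fraction {poly R}}.
Local Notation tau := (@FracField.tofrac {poly R} : {rmorphism {poly R} -> K}).
Local Notation lift := (map_poly tau).
Let tau_inj : injective tau := @tofrac_inj _.
Let tau_frac := @tofrac_fracP {poly R}.

Lemma psd2_sos_denominator (F : {poly {poly R}}) : psd2 F ->
  exists2 h : {poly R}, h != 0 & is_sos ((h ^+ 2)%:P * F).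
Proof.
move=> /(psdK_lift tau)/(psdK_sos tau_inj tau_frac)[s sE].
have [d [S [d0 SE]]] := clear_denominators_seq tau_inj tau_frac s.
exists d => //; exists S; apply: (lift_poly_inj tau_inj).
rewrite lift_poly_mulC sE rmorph_sum /= (eq_bigr (fun P => (lift P) ^+ 2)); last first.
  by move=> P _; rewrite rmorphXn.
rewrite -(big_map lift xpredT (fun q => q ^+ 2)) SE big_map scaler_sumr.
by apply: eq_bigr => q _; rewrite exprZn rmorphXn.
Qed.

Lemma dvd_coef_polyC (A : fieldType) (p : {poly A}) (F : {poly {poly A}}) :
  (forall i, p %| F`_i) -> exists G, F = p%:P * G.
Proof.
move=> pF; exists (\poly_(i < size F) (F`_i %/ p)).
apply/polyP => i; rewrite coefCM coef_poly; case: ltnP => [_|h].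
  by rewrite mulrC divpK.
by rewrite mulr0 nth_default.
Qed.

(** At a real root [r] of [h] the squares sum to 0 in R[y], so ['X - r] divides every term and
    [('X - r)^2] cancels. *)
Lemma psd2_sos_rootless_denominator (F : {poly {poly R}}) : psd2 F ->
  exists h : {poly R}, [/\ h != 0, forall x, h.[x] != 0 & is_sos ((h ^+ 2)%:P * F)].
Proof.
move=> /psd2_sos_denominator[h h0].
elim: {h}(size h) {-2}h (leqnn (size h)) h0 => [|n IHn] h.
  by rewrite leqn0 size_poly_eq0 => ->.
move=> sh h0 sF.
have [[r /factor_theorem[h' hE]]|hx] := pselect (exists r, root h r); last first.
  by exists h; split => // x; apply/negP => hx0; apply: hx; exists x.
have h'0 : h' != 0 by apply: contra_neq h0 => h'0; rewrite hE h'0 mul0r.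
apply: (IHn h') => //.
  by move: sh; rewrite hE size_Mmonic ?monicXsubC // size_XsubC addn2.
have [s sE] := sF.
have s0 : \sum_(g <- [seq map_poly (horner_eval r) g | g <- s]) g ^+ 2 = 0.
  rewrite big_map (eq_bigr (fun g => map_poly (horner_eval r) (g ^+ 2))); last first.
    by move=> g _; rewrite rmorphXn.
  rewrite -rmorph_sum -sE rmorphM /= map_polyC /= /horner_eval hE horner_exp hornerM.
  by rewrite hornerXsubC subrr mulr0 expr0n polyC0 mul0r.
have sdiv g : g \in s -> exists G, g = ('X - r%:P)%:P * G.
  move=> gs; apply: dvd_coef_polyC => i; rewrite dvdp_XsubCl.
  have := anisotropic_poly (@anisotropic_real R) s0 (map_f _ gs).
  by move/polyP/(_ i); rewrite coef_map coef0 => /eqP.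
have [t tE] : exists t, s = [seq ('X - r%:P)%:P * G | G <- t].
  elim: (s) sdiv => [|g s' IHs] sd; first by exists [::].
  have [G ->] := sd g (mem_head _ _).
  have [|t ->] := IHs; first by move=> g' g's; apply: sd; rewrite inE g's orbT.
  by exists (G :: t).
exists t; apply: (mulfI (x := ('X - r%:P)%:P ^+ 2)).
  by rewrite expf_neq0 // polyC_eq0 polyXsubC_eq0.
rewrite big_distrr /=.
under [RHS]eq_bigr do rewrite -exprMn.
rewrite -(big_map (fun G => ('X - r%:P)%:P * G) xpredT (fun g => g ^+ 2)) -tE -sE hE.
by rewrite exprMn mulrA -polyC_exp -polyCM mulrC [X in X%:P]mulrC mulrC.
Qed.

Lemma prime_factor_polyC (zeta : R[i]) (p : {poly R}) (G Q F : {poly {poly R}}) :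
    (forall q, root (map_poly (real_complex R) q) zeta -> p %| q) ->
    root (map_poly (real_complex R) p) zeta -> p%:P * F = G * Q ->
  (exists G', G = p%:P * G') \/ (exists Q', Q = p%:P * Q').
Proof.
move=> zp pz E; pose ev := map_poly (horner_eval zeta \o map_poly (real_complex R)).
have : ev G * ev Q == 0.
  by rewrite -rmorphM -E rmorphM /= map_polyC /= /horner_eval (rootP pz) polyC0 mul0r.
have H P : ev P = 0 -> exists P', P = p%:P * P'.
  move=> evP; apply: dvd_coef_polyC => i; apply: zp; apply/rootP.
  by have /polyP/(_ i) := evP; rewrite coef_map coef0.
by rewrite mulf_eq0 => /orP[/eqP/H|/eqP/H]; [left|right].
Qed.

(* Gauss's lemma: a root zeta in R[i] of a prime factor of D evaluates R[x][y] into the domain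
   R[i][y], so this factor divides G or Q. *)
Lemma square_factor_descent (D : {poly R}) : D != 0 ->
  forall F G Q : {poly {poly R}}, D%:P * F = G ^+ 2 * Q ->
  exists G' Q', F = G' ^+ 2 * Q' /\ size G' = size G.
Proof.
have step (zeta : R[i]) (p q : {poly R}) : p != 0 ->
    (forall q, root (map_poly (real_complex R) q) zeta -> p %| q) ->
    root (map_poly (real_complex R) p) zeta ->
    (forall F G Q : {poly {poly R}}, q%:P * F = G ^+ 2 * Q ->
      exists G' Q', F = G' ^+ 2 * Q' /\ size G' = size G) ->
    forall F G Q : {poly {poly R}}, (p * q)%:P * F = G ^+ 2 * Q ->
      exists G' Q', F = G' ^+ 2 * Q' /\ size G' = size G.
  move=> p0 zp pz IH F G Q; rewrite polyCM -mulrA => E.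
  have pC0 : p%:P != 0 :> {poly {poly R}} by rewrite polyC_eq0.
  have [[P]|[Q' QE]] := prime_factor_polyC zp pz E; last first.
    by apply: (IH F G Q'); apply: (mulfI pC0); rewrite E QE; ring.
  rewrite expr2 => /esym P2; have GG : exists G', G = p%:P * G'.
    by have [] := prime_factor_polyC zp pz P2.
  have [G' GE] := GG.
  have [|G1 [Q1 [-> sG1]]] := IH F G' (p%:P * Q).
    by apply: (mulfI pC0); rewrite E GE; ring.
  exists G1, Q1; split => //; rewrite sG1 GE.
  by rewrite size_Cmul.
move: D; apply: real_poly_ind => [c c0|r q q0 IH|a b q b0 q0 IH].
- move=> F G Q E; exists G, ((c^-1)%:P%:P * Q); split => //.
  rewrite mulrCA -E mulrA -!polyCM mulVf // mul1r //.
- apply: (step (r%:C)%C) => //; first by rewrite polyXsubC_eq0.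
    by move=> p; rewrite fmorph_root dvdp_XsubCl.
  by rewrite fmorph_root root_XsubC.
- apply: (step (a +i* b)%C) => //.
  + by rewrite -size_poly_eq0 size_polyDl size_exp_XsubC // size_polyC; case: eqP.
  + by move=> p; exact: dvdp_of_complex_root.
  + exact: quadratic_complex_root.
Qed.

Lemma square_factor (F : {poly {poly R}}) (g : {poly K}) :
  (1 < size g)%N -> g ^+ 2 %| lift F ->
  exists G Q : {poly {poly R}}, F = G ^+ 2 * Q /\ (1 < size G)%N.
Proof.
move=> g1 /dvdpP[r rE].
have [c [G [c0 GE]]] := clear_denominators tau_inj tau_frac g.
have [d [Q [d0 QE]]] := clear_denominators tau_inj tau_frac r.
have cd : c ^+ 2 * d != 0 by rewrite mulf_neq0 ?expf_neq0.
have [|G' [Q' [FE sG]]] := @square_factor_descent _ cd F G Q.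
  apply: (lift_poly_inj tau_inj); rewrite lift_poly_mulC rE (rmorphM lift) (rmorphXn lift) /= GE QE.
  by rewrite exprZn -scalerAl -scalerAr scalerA -rmorphXn -rmorphM [r * _]mulrC.
exists G', Q'; split => //; rewrite sG -(size_lift_poly tau_inj) GE size_scale //.
by rewrite -(rmorph0 tau) (inj_eq tau_inj).
Qed.
End RealFunctionField.

(** * Quantitative positivity *)

Definition even_powers (A : pzSemiRingType) (d : nat) (y : A) := \sum_(i < d.+1) y ^+ i.*2.

Lemma even_powersS (A : comPzRingType) d (y : A) :
  even_powers d.+1 y = 1 + y ^+ 2 * even_powers d y.
Proof.
rewrite /even_powers big_ord_recl expr0 big_distrr; congr (_ + _).
by apply: eq_bigr => i _; rewrite doubleS -addn2 addnC exprD.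
Qed.

Lemma even_powers_ge1 (R : realDomainType) d (y : R) : 1 <= even_powers d y.
Proof.
rewrite /even_powers big_ord_recl expr0 lerDl sumr_ge0 // => i _.
by rewrite -mul2n exprM exprn_ge0 // sqr_ge0.
Qed.

Lemma poly_growth (R : realFieldType) (q : {poly R}) :
  exists (C : R) a, 0 < C /\ forall x, `|q.[x]| <= C * (1 + x ^+ 2) ^+ a.
Proof.
elim/poly_ind: q => [|q c [C [a [C0 qC]]]].
  by exists 1, 0; split => // x; rewrite horner0 normr0 expr0 mulr1 ler01.
exists (C + `|c|), a.+1; split=> [|x]; first by rewrite ltr_pwDl.
have t1 : 1 <= 1 + x ^+ 2 by rewrite lerDl sqr_ge0.
have xt : `|x| <= 1 + x ^+ 2.
  by rewrite ler_norml; have := sqr_ge0 (x + 1); have := sqr_ge0 (x - 1); nra.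
rewrite !hornerE mulrDl (le_trans (ler_normD _ _)) // lerD //.
  by rewrite normrM exprSr mulrA ler_pM.
by rewrite ler_peMr // exprn_ege1.
Qed.

(** A crude Cauchy-Schwarz bound: [(u + v y)^2 <= 2 u^2 + 2 v^2 y^2] is iterated over the
    coefficients in y. *)
Lemma poly2_growth (R : realFieldType) d (U : {poly {poly R}}) : (size U <= d.+1)%N ->
  exists (C : R) a, 0 < C /\
    forall x y, U.[y%:P].[x] ^+ 2 <= C * (1 + x ^+ 2) ^+ a * even_powers d y.
Proof.
elim: d U => [|d IHd] U sU.
  rewrite (size1_polyC sU); have [C [a [C0 UC]]] := poly_growth U`_0.
  exists (C ^+ 2), (a * 2)%N; split => [|x y]; first by rewrite exprn_gt0.
  rewrite hornerC /even_powers big_ord_recl big_ord0 expr0 addr0 mulr1 exprM -exprMn.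
  rewrite -real_normK ?num_real // lerXn2r ?nnegrE ?normr_ge0 //.
  exact: le_trans (UC x).
pose V := drop_poly 1 U.
have UE : U = (U`_0)%:P + V * 'X.
  rewrite -[LHS](poly_take_drop 1 U) expr1; congr (_ + _).
  by apply/polyP => -[|i]; rewrite coef_take_poly coefC.
have [|C [a [C0 VC]]] := IHd V; first by rewrite size_drop_poly leq_subLR add1n.
have [C' [a' [C'0 UC]]] := poly_growth U`_0.
exists (2 * (C + C' ^+ 2)), (a + a' * 2)%N; split => [|x y].
  by rewrite mulr_gt0 // addr_gt0 // exprn_gt0.
have t1 : 1 <= 1 + x ^+ 2 by rewrite lerDl sqr_ge0.
rewrite [in U.[_]]UE hornerD hornerM hornerC hornerX hornerD hornerM hornerC.
set u := (U`_0).[x]; set v := V.[y%:P].[x].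
have h1 : v ^+ 2 * y ^+ 2 <= C * (1 + x ^+ 2) ^+ (a + a' * 2) * (y ^+ 2 * even_powers d y).
  rewrite [y ^+ 2 * _]mulrC [leRHS]mulrA ler_wpM2r ?sqr_ge0 // (le_trans (VC x y)) //.
  rewrite ler_wpM2r ?(le_trans ler01) ?even_powers_ge1 //.
  by rewrite ler_wpM2l ?(ltW C0) // ler_weXn2l // leq_addr.
have h2 : u ^+ 2 <= C' ^+ 2 * (1 + x ^+ 2) ^+ (a + a' * 2).
  apply: (@le_trans _ _ (C' ^+ 2 * (1 + x ^+ 2) ^+ (a' * 2))).
    have uC : `|u| <= C' * (1 + x ^+ 2) ^+ a' := UC x.
    by rewrite exprM -exprMn -real_normK ?num_real // lerXn2r ?nnegrE // (le_trans _ uC).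
  by rewrite ler_wpM2l ?sqr_ge0 // ler_weXn2l // leq_addl.
rewrite even_powersS.
have T0 : 0 <= (1 + x ^+ 2) ^+ (a + a' * 2) by rewrite exprn_ge0 // (le_trans ler01).
have e0 : 0 <= y ^+ 2 * even_powers d y.
  by rewrite mulr_ge0 ?sqr_ge0 // (le_trans ler01) // even_powers_ge1.
move: (_ ^+ (a + _)) (y ^+ 2 * even_powers d y) h1 h2 T0 e0 => T e h1 h2 T0 e0.
have h3 : (u + v * y) ^+ 2 <= 2 * (u ^+ 2) + 2 * (v ^+ 2 * y ^+ 2).
  by have := sqr_ge0 (u - v * y); nra.
have h4 : 0 <= C * T by rewrite mulr_ge0 // ltW.
have h5 : 0 <= C' ^+ 2 * T * e by apply: mulr_ge0 => //; apply: mulr_ge0 => //; exact: sqr_ge0.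
apply: (le_trans h3); nra.
Qed.

Lemma seq_Bezout (k : fieldType) (s : seq {poly k}) : exists c, (forall g, g \in s -> c %| g) /\
  exists t : seq ({poly k} * {poly k}),
    c = \sum_(p <- t) p.1 * p.2 /\ forall p, p \in t -> p.2 \in s.
Proof.
elim: s => [|g s [c [cs [t [cE tP]]]]].
  by exists 0; split => //; exists [::]; rewrite big_nil.
have [[u v] /= uv] := Bezoutp g c.
exists (u * g + v * c); split => [f|].
  rewrite inE (eqp_dvdl _ uv) => /orP[/eqP->|/cs]; first exact: dvdp_gcdl.
  by apply: dvdp_trans; exact: dvdp_gcdr.
exists ((u, g) :: [seq (v * p.1, p.2) | p <- t]); split => [|p].
  rewrite big_cons big_map /= cE big_distrr /=; congr (_ + _).
  by apply: eq_bigr => p _; rewrite mulrA.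
rewrite inE => /orP[/eqP->|/mapP[p' /tP p's ->]] /=; first exact: mem_head.
by rewrite inE p's orbT.
Qed.

(** The coefficients are reduced modulo [g], of largest degree, and the quotients are collected in
    one multiple [U g]. This multiple is [T] minus terms of degree below [2d], so [U] has degree at
    most [d]. *)
Lemma Bezout_size_le (k : fieldType) d (s : seq {poly k}) (g : {poly k})
    (t : seq ({poly k} * {poly k})) (T : {poly k}) :
    g \in s -> size g = d.+1 -> (forall f, f \in s -> size f <= d.+1)%N ->
    1 = \sum_(p <- t) p.1 * p.2 -> (forall p, p \in t -> p.2 \in s) ->
    (size T <= d.*2.+1)%N ->
  exists t' : seq ({poly k} * {poly k}), T = \sum_(p <- t') p.1 * p.2 /\
    forall p, p \in t' -> p.2 \in s /\ (size p.1 <= d.+1)%N.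
Proof.
move=> gs sg ss tE tP sT; have g0 : g != 0 by rewrite -size_poly_eq0 sg.
pose r (p : {poly k} * {poly k}) := (T * p.1) %% g.
pose U := \sum_(p <- t) (T * p.1) %/ g * p.2.
have TE : T = U * g + \sum_(p <- t) r p * p.2.
  rewrite -[LHS]mulr1 tE big_distrr big_distrl -big_split /=; apply: eq_bigr => p _.
  by rewrite mulrA [in LHS](divp_eq (T * p.1) g) /r; ring.
have sr p : (size (r p) <= d)%N by rewrite -ltnS -sg ltn_modp.
have sU : (size U <= d.+1)%N.
  have [->|U0] := eqVneq U 0; first by rewrite size_poly0.
  have : (size (U * g)%R <= d.*2.+1)%N.
    have -> : U * g = T - \sum_(p <- t) r p * p.2 by rewrite [in RHS]TE addrK.
    rewrite (leq_trans (size_polyD _ _)) // geq_max sT size_polyN.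
    rewrite (leq_trans (size_sum _ _ _)) //; apply/bigmax_leqP_seq => p pt _.
    rewrite (leq_trans (size_polyMleq _ _)) //.
    by have := sr p; have := ss _ (tP p pt); move: (size _) (size _) => a b; lia.
  rewrite size_mul // sg; move: (size U) => a; lia.
exists ((U, g) :: [seq (r p, p.2) | p <- t]); split => [|p].
  by rewrite big_cons big_map.
rewrite inE => /orP[/eqP->|/mapP[p' p't ->]] //=.
by split; [exact: tP | exact: leqW].
Qed.

Lemma max_size_seq (k : nzSemiRingType) (s : seq {poly k}) : s != [::] ->
  exists2 g, g \in s & forall f, f \in s -> (size f <= size g)%N.
Proof.
elim: s => // f s IHs _; have [->|/IHs[g gs gP]] := eqVneq s [::].
  by exists f; rewrite ?mem_head // => g; rewrite inE => /eqP ->.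
have [gf|fg] := leqP (size g) (size f).
  exists f; rewrite ?mem_head // => h; rewrite inE => /orP[/eqP->//|/gP hg].
  exact: leq_trans gf.
exists g; first by rewrite inE gs orbT.
by move=> h; rewrite inE => /orP[/eqP->|/gP//]; exact: ltnW.
Qed.

Section Slack.
Variable R : realType.
Local Notation K := {fraction {poly R}}.
Local Notation tau := (@FracField.tofrac {poly R} : {rmorphism {poly R} -> K}).
Local Notation lift := (map_poly tau).
Let tau_inj : injective tau := @tofrac_inj _.
Let tau_frac := @tofrac_fracP {poly R}.

Lemma clear_Bezout d (S : seq {poly {poly R}}) (t : seq ({poly K} * {poly K})) :
    (forall p, p \in t -> p.2 \in [seq lift G | G <- S] /\ (size p.1 <= d.+1)%N) ->
  exists (D : {poly R}) (t' : seq ({poly {poly R}} * {poly {poly R}})),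
    [/\ D != 0, tau D *: (\sum_(p <- t) p.1 * p.2) = lift (\sum_(p <- t') p.1 * p.2)
      & forall p, p \in t' -> p.2 \in S /\ (size p.1 <= d.+1)%N].
Proof.
have tau0 a : (tau a == 0) = (a == 0) by exact: tofrac_eq0.
elim: t => [|p t IHt] tP.
  by exists 1, [::]; rewrite oner_neq0 !big_nil rmorph0 scaler0.
have [|D [t' [D0 tE t'P]]] := IHt; first by move=> q qt; apply: tP; rewrite inE qt orbT.
have [/mapP[G GS pG] sp] := tP p (mem_head _ _).
have [c [U [c0 UE]]] := clear_denominators tau_inj tau_frac p.1.
exists (c * D), ((D%:P * U, G) :: [seq (c%:P * q.1, q.2) | q <- t']); split.
- by rewrite mulf_neq0.
- have E1 : lift (D%:P * U * G) = tau (c * D) *: (p.1 * p.2).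
    rewrite -mulrA lift_poly_mulC (rmorphM lift) /= UE pG -scalerAl scalerA.
    by rewrite -(rmorphM tau) [D * c]mulrC.
  rewrite !big_cons big_map /= (rmorphD lift) /= E1 scalerDr; congr (_ + _).
  rewrite (rmorphM tau) -scalerA tE -lift_poly_mulC big_distrr; congr (lift _).
  by apply: eq_bigr => q _ /=; rewrite mulrA.
- move=> q; rewrite inE => /orP[/eqP->|/mapP[q' /t'P[q'S sq] ->]] /=; split => //.
    rewrite size_Cmul // -(size_lift_poly tau_inj) UE size_scale //.
    by rewrite tau0.
  by rewrite size_Cmul.
Qed.

(** [V] will be [h^2 F], which dominates the square of each of its summands' roots [G_i]. *)
Lemma Bezout_growth d (t : seq ({poly {poly R}} * {poly {poly R}})) (V : R -> R -> R) :
    (forall x y, 0 <= V x y) ->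
    (forall p, p \in t -> (forall x y, p.2.[y%:P].[x] ^+ 2 <= V x y) /\ (size p.1 <= d.+1)%N) ->
  exists (C : R) a, 0 < C /\ forall x y, (\sum_(p <- t) p.1 * p.2).[y%:P].[x] ^+ 2
    <= C * (1 + x ^+ 2) ^+ a * even_powers d y * V x y.
Proof.
move=> V0; have eV x y : 0 <= even_powers d y * V x y.
  by rewrite mulr_ge0 // (le_trans ler01) // even_powers_ge1.
elim: t => [|p t IHt] tP.
  exists 1, 0; split => // x y; rewrite big_nil !horner0 expr0n expr0 !mul1r.
  exact: eV.
have [|C [a [C0 tC]]] := IHt; first by move=> q qt; apply: tP; rewrite inE qt orbT.
have [pV sp] := tP p (mem_head _ _).
have [C' [a' [C'0 pC]]] := poly2_growth sp.
exists (2 * (C + C')), (a + a')%N; split => [|x y]; first by rewrite mulr_gt0 // addr_gt0.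
have t1 : 1 <= 1 + x ^+ 2 by rewrite lerDl sqr_ge0.
rewrite big_cons !hornerD !hornerM.
have h1 := tC x y; have h2 : (p.1.[y%:P].[x] * p.2.[y%:P].[x]) ^+ 2 <=
    C' * (1 + x ^+ 2) ^+ a' * (even_powers d y * V x y).
  by rewrite exprMn [leRHS]mulrA; apply: ler_pM => //; exact: sqr_ge0.
rewrite -mulrA in h1.
have T1 : (1 + x ^+ 2) ^+ a <= (1 + x ^+ 2) ^+ (a + a') by rewrite ler_weXn2l // leq_addr.
have T2 : (1 + x ^+ 2) ^+ a' <= (1 + x ^+ 2) ^+ (a + a') by rewrite ler_weXn2l // leq_addl.
rewrite -[leRHS]mulrA; have := eV x y.
move: (p.1.[_].[_] * _) (_.[_].[_]) h1 h2 => u v h1 h2 e0.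
have h3 : (u + v) ^+ 2 <= 2 * u ^+ 2 + 2 * v ^+ 2 by have := sqr_ge0 (u - v); nra.
apply: (le_trans h3).
have h4 : v ^+ 2 <= C * (1 + x ^+ 2) ^+ (a + a') * (even_powers d y * V x y).
  by rewrite (le_trans h1) // ler_wpM2r // ler_wpM2l // ltW.
have h5 : u ^+ 2 <= C' * (1 + x ^+ 2) ^+ (a + a') * (even_powers d y * V x y).
  by rewrite (le_trans h2) // ler_wpM2r // ler_wpM2l // ltW.
move: h4 h5; move: (_ * V x y) (_ ^+ (a + a')) => A T; nra.
Qed.
End Slack.

Lemma even_powersX_horner2 (A : comNzRingType) d (x y : A) :
  (even_powers d ('X : {poly {poly A}})).[y%:P].[x] = even_powers d y.
Proof.
rewrite /even_powers !horner_sum; apply: eq_bigr => i _.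
by rewrite hornerXn -polyC_exp hornerC.
Qed.

Lemma size_even_powersX (A : nzRingType) d :
  (size (even_powers d ('X : {poly A})) <= d.*2.+1)%N.
Proof.
rewrite (leq_trans (size_sum _ _ _)) //; apply/bigmax_leqP => i _.
by rewrite size_polyXn ltnS leq_double -ltnS.
Qed.

Section Slack.
Variable R : realType.
Local Notation K := {fraction {poly R}}.
Local Notation tau := (@FracField.tofrac {poly R} : {rmorphism {poly R} -> K}).
Local Notation lift := (map_poly tau).
Let tau_inj : injective tau := @tofrac_inj _.

(* If h^2 F = sum_i G_i^2, the G_i are coprime over R(x); from D q = sum_i U_i G_i with the y-degree
   of each U_i at most d, D^2 q^2 <= C theta^a q h^2 F, where q = even_powers d y. *)
Lemma squarefree_slack (F : {poly {poly R}}) : F != 0 -> psd2 F ->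
    (forall g : {poly K}, (1 < size g)%N -> ~~ (g ^+ 2 %| lift F)) ->
  exists d N rs (c : R), [/\ (size F <= d.*2.+1)%N, 0 < c &
    forall x y, c * (\prod_(r <- rs) (x - r)) ^+ 2 * even_powers d y
      <= (1 + x ^+ 2) ^+ N * F.[y%:P].[x]].
Proof.
move=> F0 Fpsd sqf; have [h h0 [S SE]] := psd2_sos_denominator Fpsd.
have hC0 : (h ^+ 2)%:P != 0 :> {poly {poly R}} by rewrite polyC_eq0 expf_neq0.
have hF0 : (h ^+ 2)%:P * F != 0 by rewrite mulf_neq0.
have S0 : S != [::] by apply: contra_neq hF0 => S0; rewrite SE S0 big_nil.
have [g gS gmax] := max_size_seq S0.
have g0 : g != 0.
  apply: contra_neq hF0 => g0; rewrite SE big_seq big1 // => f /gmax.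
  by rewrite g0 size_poly0 leqn0 size_poly_eq0 => /eqP->; rewrite expr0n.
pose d := (size g).-1.
have sg : size g = d.+1 by rewrite prednK // size_poly_gt0.
have sF : (size F <= d.*2.+1)%N.
  rewrite -(size_Cmul F (expf_neq0 2 h0)) SE (leq_trans (size_sum _ _ _)) //.
  apply/bigmax_leqP_seq => f /gmax; rewrite sg => sf _.
  rewrite expr2 (leq_trans (size_polyMleq _ _)) //; move: (size f) sf => a; lia.
have [c [cS [t [tE tP]]]] := seq_Bezout [seq lift G | G <- S].
have c0 : c != 0.
  apply/eqP => c0; have := cS _ (map_f _ gS).
  by rewrite c0 dvd0p -size_poly_eq0 (size_lift_poly tau_inj) size_poly_eq0 (negPf g0).
(* [c] divides every lifted [G], so [c^2] divides [h^2 F], where [h] is a unit of [K]; the absence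
   of square factors makes [c] constant. *)
have cF : c ^+ 2 %| lift F.
  have : c ^+ 2 %| lift ((h ^+ 2)%:P * F).
    rewrite SE rmorph_sum big_seq; apply: (big_ind (fun q => c ^+ 2 %| q)) => [|u v|f fS]; first exact: dvdp0.
      exact: dvdp_add.
    by rewrite rmorphXn /= dvdp_exp2r // cS // map_f.
  by rewrite lift_poly_mulC dvdpZr // tofrac_eq0 expf_neq0.
have sc : (size c <= 1)%N by rewrite leqNgt; apply/negP => /sqf; rewrite cF.
have cE := size1_polyC sc; set gam := c`_0 in cE.
have gam0 : gam != 0 by rewrite -polyC_eq0 -cE.
(* The weight q itself is represented, instead of 1: squaring puts [D^2 q^2] on the left, the
   coefficients of degree at most [d] cost one factor q, and one q is left for the slack. *)
have [||||||t1 [t1E t1P]] := @Bezout_size_le _ d [seq lift G | G <- S] (lift g)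
  [seq (gam^-1 *: p.1, p.2) | p <- t] (lift (even_powers d 'X)).
- exact: map_f.
- by rewrite (size_lift_poly tau_inj).
- by move=> _ /mapP[G /gmax sG ->]; rewrite (size_lift_poly tau_inj) -sg.
- rewrite big_map /= -[LHS](scale1r 1) -(mulVf gam0) -scalerA alg_polyC -cE tE scaler_sumr.
  by apply: eq_bigr => p _; rewrite scalerAl.
- by move=> _ /mapP[p /tP pS ->].
- by rewrite (size_lift_poly tau_inj) size_even_powersX.
have [D [t2 [D0 t2E t2P]]] := clear_Bezout t1P.
have DE : D%:P * even_powers d 'X = \sum_(p <- t2) p.1 * p.2.
  by apply: (lift_poly_inj tau_inj); rewrite lift_poly_mulC t1E t2E.
pose V x y := h.[x] ^+ 2 * F.[y%:P].[x].
have VE x y : V x y = \sum_(G <- S) G.[y%:P].[x] ^+ 2.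
  have := congr1 (fun P => P.[y%:P].[x]) SE.
  rewrite /= hornerM hornerC hornerM horner_exp -/(V x y) => ->.
  by rewrite !horner_sum; apply: eq_bigr => G _; rewrite !horner_exp.
have [||C [a [C0 CP]]] := @Bezout_growth R d t2 V.
- by move=> x y; rewrite mulr_ge0 ?sqr_ge0.
- move=> p /t2P[pS sp]; split => // x y; rewrite VE (big_rem _ pS) /= lerDl.
  by apply: sumr_ge0 => G _; exact: sqr_ge0.
have [C' [a' [C'0 hC]]] := poly_growth h.
have [rs [k [s [Dk k0 ss [m m0 sm]]]]] := real_poly_split D0.
pose M := C * C' ^+ 2.
have M0 : 0 < M by rewrite mulr_gt0 // exprn_gt0.
(* [k m] comes from [D = k P s] with [s >= m], and the exponent [a' * 2] from bounding [h^2]. *)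
exists d, (a + a' * 2)%N, rs, ((k * m) ^+ 2 / M); split => //.
  by rewrite divr_gt0 // exprn_even_gt0 // mulf_neq0 // lt0r_neq0.
move=> x y; set P := \prod_(r <- rs) (x - r).
have t1' : 1 <= 1 + x ^+ 2 by rewrite lerDl sqr_ge0.
have e0 : 0 < even_powers d y by rewrite (lt_le_trans ltr01) // even_powers_ge1.
have DxE : D.[x] = k * (P * s.[x]).
  rewrite Dk hornerZ hornerM; congr (_ * (_ * _)).
  by rewrite horner_prod; apply: eq_bigr => r _; rewrite hornerXsubC.
have Dx : (k * m) ^+ 2 * P ^+ 2 <= D.[x] ^+ 2.
  rewrite DxE [k * (P * _)]mulrCA mulrC [leRHS]exprMn ler_wpM2l ?sqr_ge0 //.
  by rewrite !exprMn ler_wpM2l ?sqr_ge0 // lerXn2r ?nnegrE ?(ltW m0) // (le_trans (ltW m0)).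
have hx : h.[x] ^+ 2 <= C' ^+ 2 * (1 + x ^+ 2) ^+ (a' * 2).
  have hC' := hC x.
  by rewrite exprM -exprMn -real_normK ?num_real // lerXn2r ?nnegrE // (le_trans _ hC').
have := CP x y; rewrite -DE hornerM hornerC hornerM even_powersX_horner2 exprMn.
rewrite [even_powers d y ^+ 2]expr2 -[leRHS]mulrA [even_powers d y * V x y]mulrC [leRHS]mulrA mulrA.
rewrite ler_pM2r // => key.
rewrite [_ / M * _]mulrAC [leLHS]mulrAC ler_pdivrMr //.
apply: (@le_trans _ _ (D.[x] ^+ 2 * even_powers d y)); first by rewrite ler_wpM2r // ltW.
apply: (le_trans key); rewrite /V /M exprD.
have T0 : 0 <= (1 + x ^+ 2) ^+ a by rewrite exprn_ge0 // (le_trans ler01).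
have F0' := Fpsd x y.
have CT : 0 <= C * (1 + x ^+ 2) ^+ a by rewrite mulr_ge0 // ltW.
rewrite mulrA (_ : _ * (C * C' ^+ 2) =
  C * (1 + x ^+ 2) ^+ a * (C' ^+ 2 * (1 + x ^+ 2) ^+ (a' * 2)) * F.[y%:P].[x]); last ring.
by rewrite ler_wpM2r // ler_wpM2l.
Qed.
End Slack.

(* Each power y^(2i) comes with 4A: 2A absorb the coefficient of y^(2i) and A goes to each neighbouring
   odd power, through A (1 + y^2) + g y = u (1 + y)^2 + v (1 - y)^2 with u, v = A/2 +- g/4. *)
Lemma diagonally_dominant_sos (R : realType) d (A : {poly R}) (G : {poly {poly R}}) :
    (size G <= d.*2.+1)%N -> (forall (j : nat) (x : R), `|(G`_j).[x]| <= 2 * A.[x]) ->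
  is_sos ((A *+ 4)%:P * even_powers d 'X - A%:P + G).
Proof.
have A_ge0 (H : {poly {poly R}}) : (forall (j : nat) (x : R), `|(H`_j).[x]| <= 2 * A.[x]) -> forall x, 0 <= A.[x].
  by move=> HA x; have := le_trans (normr_ge0 _) (HA 0 x); rewrite pmulr_rge0.
elim: d G => [|d IHd] G sG GA.
  rewrite (size1_polyC sG) /even_powers big_ord_recl big_ord0 expr0 addr0 mulr1.
  rewrite -polyCB -polyCD; apply: (sos_rmorph polyC); apply: psd_sos => x.
  rewrite hornerD hornerD hornerN hornerMn; have := GA 0 x; have := A_ge0 _ GA x.
  by rewrite ler_norml => ? /andP[]; lra.
pose G' := drop_poly 2 G.
have sos_C (p : {poly R}) : (forall x, 0 <= p.[x]) -> is_sos p%:P.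
  by move=> px; apply: (sos_rmorph polyC); exact: psd_sos.
have GE : G = (G`_0)%:P + (G`_1)%:P * 'X + 'X ^+ 2 * G'.
  rewrite -[LHS](poly_take_drop 2 G) [_ * 'X^2]mulrC; congr (_ + _).
  apply/polyP => -[|[|i]]; rewrite coef_take_poly coefD coefMX coefC //= ?addr0 ?coefC ?add0r //.
pose u := 2^-1 *: A + 4^-1 *: G`_1; pose v := 2^-1 *: A - 4^-1 *: G`_1.
have AE : A = u + v by rewrite /u /v addrACA subrr addr0 -scalerDl -div1r -splitr scale1r.
have g1E : G`_1 = (u - v) *+ 2.
  rewrite /u /v opprB addrC subrKA -scalerDl -scaler_nat scalerA.
  by rewrite (_ : 2 * _ = 1) ?scale1r //; field.
(* The subtracted [A] is the share that the lowest even power has lent to the odd power below it;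
   with it the induction closes. *)
have -> : (A *+ 4)%:P * even_powers d.+1 'X - A%:P + G =
  (A *+ 2 + G`_0)%:P + (u%:P * (1 + 'X) ^+ 2 + v%:P * (1 - 'X) ^+ 2)
  + 'X ^+ 2 * ((A *+ 4)%:P * even_powers d 'X - A%:P + G').
  have E1 : (A *+ 2 + G`_0)%:P = A%:P *+ 2 + (G`_0)%:P by rewrite polyCD polyCMn.
  have E2 : (G`_1)%:P = (u%:P - v%:P) *+ 2 by rewrite g1E polyCMn polyCB.
  have E3 : A%:P = u%:P + v%:P by rewrite -polyCD -AE.
  rewrite even_powersS [in LHS]GE E1 E2 polyCMn E3.
  by move: (even_powers _ _) (u%:P) (v%:P) (G`_0)%:P => Q U V G0; ring.
have G1 x := GA 1 x; have Ax := A_ge0 _ GA.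
apply: sosD; last first.
  apply: sos_sqrM; apply: IHd; last by move=> j x; rewrite coef_drop_poly.
  by rewrite size_drop_poly leq_subLR; move: sG; rewrite doubleS add2n.
apply: sosD; first apply: sos_C => x.
  by rewrite hornerD hornerMn; have := GA 0 x; rewrite ler_norml => /andP[]; lra.
apply: sosD; rewrite mulrC; apply: sos_sqrM; apply: sos_C => x.
  by rewrite hornerD !hornerZ; have := G1 x; rewrite ler_norml => /andP[]; lra.
by rewrite hornerD hornerN !hornerZ; have := G1 x; rewrite ler_norml => /andP[]; lra.
Qed.

(** * Changing the denominator *)

(** The exponent is half the degree bound, so that for [h^2] it matches the exponent of the lower
    bound in [no_root_sqr_ge]. *)
Lemma poly_growth_size (R : realFieldType) m (q : {poly R}) : (size q <= m.*2.+1)%N ->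
  exists2 C : R, 0 < C & forall x, `|q.[x]| <= C * (1 + x ^+ 2) ^+ m.
Proof.
elim: m q => [|m IHm] q sq.
  rewrite (size1_polyC sq); exists (`|q`_0| + 1) => [|x]; first by rewrite ltr_wpDl.
  by rewrite hornerC expr0 mulr1 lerDl.
have [|C C0 CP] := IHm (drop_poly 2 q).
  by rewrite size_drop_poly leq_subLR; move: sq; rewrite doubleS add2n.
exists (C + (`|q`_0| + `|q`_1|)) => [|x]; first by rewrite ltr_pwDl // addr_ge0.
have t1 : 1 <= 1 + x ^+ 2 by rewrite lerDl sqr_ge0.
have qE : q.[x] = (drop_poly 2 q).[x] * x ^+ 2 + (q`_0 + q`_1 * x).
  rewrite -[in LHS](poly_take_drop 2 q) hornerD hornerM hornerXn addrC; congr (_ + _).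
  have -> : take_poly 2 q = (q`_0)%:P + (q`_1)%:P * 'X.
    by apply/polyP => -[|[|i]]; rewrite coef_take_poly coefD coefMX coefC //= ?addr0 ?coefC ?add0r.
  by rewrite !hornerE.
rewrite qE (le_trans (ler_normD _ _)) // mulrDl lerD //.
  rewrite normrM [_ ^+ m.+1]exprSr [leRHS]mulrA; apply: ler_pM => //.
  by rewrite normrX real_normK ?num_real // lerDr.
have xt : `|x| <= 1 + x ^+ 2.
  by rewrite ler_norml; have := sqr_ge0 (x + 1); have := sqr_ge0 (x - 1); nra.
apply: (@le_trans _ _ ((`|q`_0| + `|q`_1|) * (1 + x ^+ 2))).
  rewrite mulrDl (le_trans (ler_normD _ _)) // lerD //; first by rewrite ler_peMr.
  by rewrite normrM ler_wpM2l.
by rewrite ler_wpM2l ?addr_ge0 // [_ ^+ m.+1]exprS ler_peMr ?(le_trans ler01) // exprn_ege1.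
Qed.

Lemma coef_growth (R : realFieldType) (F : {poly {poly R}}) :
  exists (C : R) a, 0 < C /\ forall (j : nat) (x : R), `|(F`_j).[x]| <= C * (1 + x ^+ 2) ^+ a.
Proof.
elim/poly_ind: F => [|F q [C [a [C0 FC]]]].
  exists 1, 0; split => // j x; rewrite coef0 horner0 normr0 expr0 mulr1.
  exact: ler01.
have [C' [a' [C'0 qC]]] := poly_growth q.
exists (C + C'), (a + a')%N; split; first exact: addr_gt0.
move=> j x; have t1 : 1 <= 1 + x ^+ 2 by rewrite lerDl sqr_ge0.
have T0 n : 0 <= (1 + x ^+ 2) ^+ n by rewrite exprn_ge0 // (le_trans ler01).
have T1 : (1 + x ^+ 2) ^+ a <= (1 + x ^+ 2) ^+ (a + a') by rewrite ler_weXn2l // leq_addr.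
have T2 : (1 + x ^+ 2) ^+ a' <= (1 + x ^+ 2) ^+ (a + a') by rewrite ler_weXn2l // leq_addl.
rewrite coefD coefMX coefC mulrDl; case: j => [|j] /=.
  rewrite add0r (le_trans (qC x)) // ler_wpDl ?mulr_ge0 ?(ltW C0) //.
  by rewrite ler_wpM2l // ltW.
rewrite addr0 (le_trans (FC j x)) // ler_wpDr ?mulr_ge0 ?(ltW C'0) //.
by rewrite ler_wpM2l // ltW.
Qed.

(** Bernoulli's inequality in the form [q^n (1 + n (1 - q)) <= 1]. *)
Lemma exprn_small (R : archiRealFieldType) (q eps : R) :
  0 <= q -> q < 1 -> 0 < eps -> exists n, q ^+ n <= eps.
Proof.
move=> q0 q1 e0; pose d := 1 - q; have d0 : 0 < d by rewrite subr_gt0.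
have bern n : q ^+ n * (1 + n%:R * d) <= 1.
  elim: n => [|n IHn]; first by rewrite expr0 mul0r addr0 mulr1.
  apply: le_trans IHn; rewrite exprSr -mulrA ler_wpM2l ?exprn_ge0 //.
  have n0 : 0 <= n%:R :> R by exact: ler0n.
  by rewrite -natr1 /d; have := mulr_ge0 n0 (sqr_ge0 d); rewrite /d; nra.
pose n := Num.bound (d * eps)^-1; exists n.
have de0 : 0 < d * eps by exact: mulr_gt0.
have nde : 1 <= n%:R * d * eps.
  have : (d * eps)^-1 < n%:R.
    by apply: archi_boundP; rewrite invr_ge0 ltW.
  by rewrite -mulrA -ler_pdivrMr // div1r => /ltW.
have q_ge0 : 0 <= q ^+ n by rewrite exprn_ge0.
have := bern n; move: (q ^+ n) q_ge0 (n%:R) nde => Q Q0 m mde h.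
have : Q * (m * d * eps) <= eps by nra.
by apply: le_trans; rewrite ler_peMr.
Qed.

Lemma gluing (R : realType) (F : {poly {poly R}}) d (rs : seq R) (c : R) :
    (size F <= d.*2.+1)%N -> 0 < c ->
    (forall x y, c * (\prod_(r <- rs) (x - r)) ^+ 2 * even_powers d y <= F.[y%:P].[x]) ->
  exists k, is_sos (((1 + 'X ^+ 2) ^+ k)%:P * F).
Proof.
move=> sF c0 slack; pose th : {poly R} := 1 + 'X ^+ 2.
have thE x n : (th ^+ n).[x] = (1 + x ^+ 2) ^+ n.
  by rewrite horner_exp hornerD hornerXn hornerC.
have th1 x : 1 <= 1 + x ^+ 2 :> R by rewrite lerDl sqr_ge0.
have th_gt0 x n : 0 < (1 + x ^+ 2) ^+ n :> R by rewrite exprn_gt0 // (lt_le_trans ltr01).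
pose P : {poly R} := \prod_(r <- rs) ('X - r%:P); pose p := c *: P ^+ 2.
pose q : {poly {poly R}} := even_powers d 'X.
have pE x : p.[x] = c * (\prod_(r <- rs) (x - r)) ^+ 2.
  rewrite hornerZ horner_exp horner_prod; congr (_ * _ ^+ 2).
  by apply: eq_bigr => r _; rewrite hornerXsubC.
have [h [h0 hx hsos]] : exists h : {poly R}, [/\ h != 0, forall x, h.[x] != 0
    & is_sos ((h ^+ 2)%:P * (F - p%:P * q))].
  apply: psd2_sos_rootless_denominator => x y.
  by rewrite hornerD hornerN hornerM hornerC hornerD hornerN hornerM even_powersX_horner2 pE subr_ge0.
pose D := (size h).-1; pose g := h ^+ 2.
have g0 : g != 0 by rewrite expf_neq0.
have sg : size g = D.*2.+1.
  by rewrite -(@prednK (size g)) ?size_poly_gt0 // size_exp muln2.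
have gx x : 0 < g.[x] by rewrite /g horner_exp exprn_even_gt0 // hx.
have cop : coprimep p g.
  rewrite coprimepZl ?lt0r_neq0 // coprimep_expl // coprimep_expr //.
  rewrite coprimep_sym; apply: (big_ind (fun u => coprimep h u)) => [|u v|r _].
  - exact: coprimep1.
  - by rewrite coprimepMr => -> ->.
  - by rewrite coprimep_XsubC /root hx.
have [C1 [m1 [C10 pC]]] := poly_growth p.
have [C2 [m2 [C20 FC]]] := coef_growth F.
(* [theta^D] will bound [S], and [theta^m] bounds [p] and the coefficients of [F]. Reduction modulo
   [g] keeps the degree of [S] independent of [N']. *)
pose m := (m1 + m2)%N; pose N' := (D + m)%N.
have [S [W [SW sS]]] : exists S W : {poly R}, p * S + W * g = th ^+ N' /\ (size S <= D.*2.+1)%N.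
  have /Bezout_eq1_coprimepP[[u v] /= E] := cop.
  exists ((u * th ^+ N') %% g), (v * th ^+ N' + p * ((u * th ^+ N') %/ g)); split.
    rewrite -[RHS]mul1r -E !mulrDl [u * p * _]mulrAC {3}(divp_eq (u * th ^+ N') g); ring.
  by rewrite -sg ltnW // ltn_modp.
have [C3 C30 SC] := poly_growth_size sS.
have [|C4 C40 gC] := @poly_growth_size R D g; first by rewrite sg.
have [c5 c50 hc] := no_root_sqr_ge h0 hx.
have gc x : c5 * (1 + x ^+ 2) ^+ D <= g.[x] by rewrite /g horner_exp; exact: hc.
have cC : c5 <= C4.
  have := le_trans (gc 0) (le_trans (ler_norm _) (gC 0)).
  by rewrite ler_pM2r.
(* Up to powers of theta, e = (1 - H)^n p S with H = g / C4 and p S = 1 mod g. *)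
pose E := th ^+ D - C4^-1 *: g.
(* [g / theta^D] lies between [c5] and [C4], so [E / theta^D] lies between 0 and [del < 1]. *)
pose del := 1 - c5 / C4.
have del0 : 0 <= del by rewrite subr_ge0 ler_pdivrMr // mul1r.
have del1 : del < 1 by rewrite ltrBlDr ltrDl divr_gt0.
have Ex x : 0 <= E.[x] <= del * (1 + x ^+ 2) ^+ D.
  rewrite hornerD hornerN hornerZ thE; apply/andP; split.
    by rewrite subr_ge0 mulrC ler_pdivrMr // mulrC (le_trans (ler_norm _)) // gC.
  rewrite /del mulrBl mul1r lerD2l lerN2 [c5 / _]mulrC -mulrA.
  by rewrite ler_wpM2l ?invr_ge0 ?(ltW C40).
have CC0 : 0 < (C1 + C2) * C3 by rewrite mulr_gt0 // addr_gt0.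
(* With 1/4, [B >= 3/4 theta^k]; then [2 A = B / 2 >= 3/8 theta^k] exceeds the bound [1/4 theta^k]
   on the perturbing coefficients. [C1 + C2] serves [p] and [F] at once. *)
have [n nP] : exists n, del ^+ n <= 4^-1 / ((C1 + C2) * C3).
  by apply: exprn_small => //; rewrite divr_gt0 // invr_gt0.
pose k := (D * n + N')%N.
have small (u : {poly R}) : (forall x, `|u.[x]| <= (C1 + C2) * (1 + x ^+ 2) ^+ m) ->
    forall x, `|(E ^+ n * S * u).[x]| <= 4^-1 * (1 + x ^+ 2) ^+ k.
  move=> uC x; rewrite !hornerM !normrM horner_exp normrX.
  have [E0 E1] := andP (Ex x); rewrite (ger0_norm E0).
  have En : E.[x] ^+ n <= del ^+ n * (1 + x ^+ 2) ^+ (D * n).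
    by rewrite exprM -exprMn lerXn2r // nnegrE // mulr_ge0 // ltW.
  have h1 : E.[x] ^+ n * `|S.[x]| <=
      del ^+ n * (1 + x ^+ 2) ^+ (D * n) * (C3 * (1 + x ^+ 2) ^+ D).
    by apply: ler_pM => //; rewrite exprn_ge0.
  have h2 := ler_pM (mulr_ge0 (exprn_ge0 n E0) (normr_ge0 _)) (normr_ge0 _) h1 (uC x).
  apply: (le_trans h2); rewrite /k /N' [_ ^+ (D * n + _)]exprD [_ ^+ (D + m)]exprD.
  have : del ^+ n * ((C1 + C2) * C3) <= 4^-1 by rewrite -ler_pdivlMr.
  have := th_gt0 x (D * n)%N; have := th_gt0 x D; have := th_gt0 x m.
  move: ((1 + x ^+ 2) ^+ (D * n)) ((1 + x ^+ 2) ^+ D) ((1 + x ^+ 2) ^+ m) (del ^+ n).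
  move=> T1 T2 T3 Q T30 T20 T10 key.
  have T0 : 0 <= T1 * (T2 * T3) by rewrite !mulr_ge0 // ltW.
  have -> : Q * T1 * (C3 * T2) * ((C1 + C2) * T3) = Q * ((C1 + C2) * C3) * (T1 * (T2 * T3)).
    by ring.
  by rewrite ler_wpM2r.
have weight (v : R) C a (x : R) : C <= C1 + C2 -> 0 <= C -> (a <= m)%N ->
    v <= C * (1 + x ^+ 2) ^+ a -> v <= (C1 + C2) * (1 + x ^+ 2) ^+ m.
  move=> CC C0 am /le_trans; apply; apply: ler_pM => //; first exact: ltW.
  by rewrite ler_weXn2l.
have smallp x : `|(E ^+ n * S * p).[x]| <= 4^-1 * (1 + x ^+ 2) ^+ k.
  apply: small => z; apply: (weight _ C1 m1) => //; first by rewrite lerDl ltW.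
    exact: ltW.
  exact: leq_addr.
have smallF (j : nat) x : `|(E ^+ n * S * F`_j).[x]| <= 4^-1 * (1 + x ^+ 2) ^+ k.
  apply: small => z; apply: (weight _ C2 m2) => //; first by rewrite lerDr ltW.
    exact: ltW.
  exact: leq_addl.
pose B := th ^+ k - E ^+ n * S * p.
have Bx x : 3 / 4 * (1 + x ^+ 2) ^+ k <= B.[x].
  rewrite hornerD hornerN thE; have := smallp x; rewrite ler_norml => /andP[_]; lra.
(* Modulo [g], both [theta^D = E] and [theta^N' = p S], hence [theta^k = E^n S p]. *)
have [w wE] : exists w, B = w * g.
  have /dvdpP[w1 w1E] : g %| th ^+ (D * n) - E ^+ n.
    rewrite exprM subrXX dvdp_mulr // /E opprB addrC subrK.
    by rewrite dvdpZr ?invr_eq0 ?lt0r_neq0.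
  exists (w1 * th ^+ N' + E ^+ n * W).
  rewrite mulrDl [w1 * _ * _]mulrAC -w1E /B /k exprD.
  have -> : E ^+ n * S * p = E ^+ n * (th ^+ N' - W * g) by rewrite -SW addrK; ring.
  by ring.
have w_sos : is_sos w.
  apply: psd_sos => x; rewrite -(pmulr_lge0 _ (gx x)) -hornerM -wE.
  by rewrite (le_trans _ (Bx x)) // mulr_ge0 ?divr_ge0 // ltW.
have p_sos : is_sos p.
  by rewrite /p -mul_polyC -(sqr_sqrtr (ltW c0)) polyC_exp -exprMn; exact: sos_sqr.
exists k; rewrite -/th.
have -> : (th ^+ k)%:P * F = w%:P * (g%:P * (F - p%:P * q))
    + p%:P * (B%:P * q + (E ^+ n * S)%:P * F).
  have -> : w%:P * (g%:P * (F - p%:P * q)) = B%:P * (F - p%:P * q).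
    by rewrite mulrA -polyCM -wE.
  rewrite /B polyCB [(E ^+ n * S * p)%:P]polyCM; ring.
apply: sosD; apply: sosM => //; [exact: sos_rmorph|exact: sos_rmorph|].
pose A := 4^-1 *: B.
have BE : B = A *+ 4 by rewrite -scaler_nat scalerA divff ?scale1r // pnatr_eq0.
have sosA : is_sos A.
  apply: psd_sos => x; rewrite hornerZ mulr_ge0 ?invr_ge0 ?(le_trans _ (Bx x)) //.
  by rewrite mulr_ge0 ?divr_ge0 // ltW.
have -> : B%:P * q + (E ^+ n * S)%:P * F
  = A%:P + ((A *+ 4)%:P * q - A%:P + (E ^+ n * S)%:P * F) by rewrite BE; ring.
apply: sosD; first exact: sos_rmorph.
apply: diagonally_dominant_sos => [|j x].
  have [->|ES0] := eqVneq (E ^+ n * S) 0; first by rewrite polyC0 mul0r size_poly0.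
  by rewrite size_Cmul.
rewrite coefCM (le_trans (smallF j x)) // hornerZ.
by have := Bx x; have := th_gt0 x k; lra.
Qed.

Lemma psd2_sos_theta (R : realType) (F : {poly {poly R}}) : psd2 F ->
  exists k, is_sos (((1 + 'X ^+ 2) ^+ k)%:P * F).
Proof.
elim: {F}(size F) {-2}F (leqnn (size F)) => [|n IHn] F.
  by rewrite leqn0 size_poly_eq0 => /eqP-> _; exists 0; rewrite mulr0; exact: sos0.
move=> sF Fpsd; have [->|F0] := eqVneq F 0.
  by exists 0; rewrite mulr0; exact: sos0.
have [[g g1 gF]|sqf] := pselect (exists2 g : {poly {fraction {poly R}}}, (1 < size g)%N &
    g ^+ 2 %| map_poly (@FracField.tofrac {poly R} : {rmorphism {poly R} -> {fraction {poly R}}}) F).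
  have [G [Q [FE G1]]] := square_factor g1 gF.
  have G0 : G != 0 by rewrite -size_poly_gt0 (ltn_trans _ G1).
  have Q0 : Q != 0 by apply: contra_neq F0 => Q0; rewrite FE Q0 mulr0.
  have [||k ksos] := IHn Q.
  - move: sF G1; rewrite FE size_mul ?expf_neq0 // expr2 size_mul //.
    by move: (size G) (size Q) => a b; lia.
  - apply: (psd2_dense G0) => x y Gxy; have := Fpsd x y.
    by rewrite FE hornerM horner_exp hornerM horner_exp pmulr_rge0 // exprn_even_gt0.
  by exists k; rewrite FE mulrCA; exact: sos_sqrM.
have [|d [N [rs [c [sFd c0 slack]]]]] := squarefree_slack F0 Fpsd.
  by move=> g g1; apply/negP => gF; apply: sqf; exists g.
have th0 : (1 + 'X ^+ 2) ^+ N != 0 :> {poly R}.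
  apply/eqP => /(congr1 (horner_eval 0)); rewrite /horner_eval horner_exp !hornerE.
  by rewrite expr0n addr0 expr1n => /eqP; rewrite oner_eq0.
have [||k ksos] := @gluing R (((1 + 'X ^+ 2) ^+ N)%:P * F) d rs c _ c0.
- by rewrite size_Cmul.
- by move=> x y; rewrite hornerM hornerC hornerM horner_exp hornerD hornerXn hornerC.
by exists (k + N)%N; rewrite exprD polyCM -mulrA.
Qed.

(** * Transfer to {mpoly R[2]} *)

Section Bivariate.
Variable A : comNzRingType.

Definition mpoly_of_inner : {poly A} -> {mpoly A[2]} :=
  horner_eval 'X_ord0 \o map_poly (@mpolyC 2 A).
HB.instance Definition _ := GRing.RMorphism.on mpoly_of_inner.

Definition mpoly_of_poly2 : {poly {poly A}} -> {mpoly A[2]} :=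
  horner_eval 'X_ord_max \o map_poly mpoly_of_inner.
HB.instance Definition _ := GRing.RMorphism.on mpoly_of_poly2.

Lemma mpoly_of_innerC c : mpoly_of_inner c%:P = c%:MP.
Proof. by rewrite /mpoly_of_inner /= /horner_eval map_polyC hornerC. Qed.

Lemma mpoly_of_innerX : mpoly_of_inner 'X = 'X_ord0.
Proof. by rewrite /mpoly_of_inner /= /horner_eval map_polyX hornerX. Qed.

Lemma mpoly_of_poly2C p : mpoly_of_poly2 p%:P = mpoly_of_inner p.
Proof. by rewrite /mpoly_of_poly2 /= /horner_eval map_polyC hornerC. Qed.

Lemma mpoly_of_poly2X : mpoly_of_poly2 'X = 'X_ord_max.
Proof. by rewrite /mpoly_of_poly2 /= /horner_eval map_polyX hornerX. Qed.

(** A preimage of [f] inherits nonnegativity through evaluation, and its sums of squares are pushed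
    forward by the morphism. *)
Lemma mpoly_of_poly2_surj (f : {mpoly A[2]}) : exists F, mpoly_of_poly2 F = f.
Proof.
exists (\sum_(m <- msupp f) (f@_m *: 'X^(m ord0))%:P * 'X^(m ord_max)).
rewrite [RHS]mpolyE rmorph_sum; apply: eq_bigr => m _.
rewrite rmorphM rmorphXn /= mpoly_of_poly2C mpoly_of_poly2X -mul_polyC.
rewrite rmorphM rmorphXn /= mpoly_of_innerC mpoly_of_innerX mul_mpolyC -scalerAl.
congr (_ *: _); rewrite [RHS]mpolyXE_id !big_ord_recl big_ord0 mulr1.
by rewrite (_ : lift ord0 ord0 = ord_max) //; apply: val_inj.
Qed.

Lemma meval_mpoly_of_poly2 (F : {poly {poly A}}) (v : 'I_2 -> A) :
  (mpoly_of_poly2 F).@[v] = F.[(v ord_max)%:P].[v ord0].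
Proof.
have inner p : (mpoly_of_inner p).@[v] = p.[v ord0].
  elim/poly_ind: p => [|p c IH].
rewrite (rmorph0 mpoly_of_inner).
by rewrite  meval0 horner0.
rewrite (rmorphD mpoly_of_inner).
rewrite (rmorphM mpoly_of_inner).
rewrite /=.
rewrite mpoly_of_innerC mpoly_of_innerX.
rewrite mevalD mevalM mevalXU.
rewrite mevalC IH.
by rewrite !hornerE.
elim/poly_ind: F => [|F p IH].
by rewrite (rmorph0 mpoly_of_poly2) meval0 !horner0.
rewrite (rmorphD mpoly_of_poly2) (rmorphM mpoly_of_poly2).
rewrite /=.
rewrite mpoly_of_poly2C mpoly_of_poly2X.
rewrite mevalD mevalM mevalXU IH inner.
by rewrite !hornerE.
Qed.
End Bivariate.

(* The variables x and y are 'X_0 and 'X_1. *)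
Theorem theorem3 (R : realType) (f : {mpoly R[2]})
    (f_ge0 : forall v : 'I_2 -> R, 0 <= f.@[v]) :
  exists k : nat, is_sos ((1 + 'X_ord0 ^+ 2) ^+ k * f).
Proof.
have [F fE] := mpoly_of_poly2_surj f.
have Fpsd : psd2 F.
  move=> x y; have := f_ge0 (fun i => if i == ord0 then x else y).
  by rewrite -fE meval_mpoly_of_poly2.
have [k [s sE]] := psd2_sos_theta Fpsd.
exists k.
have -> : (1 + 'X_ord0 ^+ 2) ^+ k * f = mpoly_of_poly2 (((1 + 'X ^+ 2) ^+ k)%:P * F).
  rewrite (rmorphM (@mpoly_of_poly2 R)) /= fE mpoly_of_poly2C.
  rewrite (rmorphXn (@mpoly_of_inner R)) (rmorphD (@mpoly_of_inner R)).
  rewrite (rmorph1 (@mpoly_of_inner R)) (rmorphXn (@mpoly_of_inner R)) /=.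
  by rewrite mpoly_of_innerX.
rewrite sE; exists [seq mpoly_of_poly2 g | g <- s].
rewrite (rmorph_sum (@mpoly_of_poly2 R)) big_map; apply: eq_bigr => g _.
exact: (rmorphXn (@mpoly_of_poly2 R)).
Qed.
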